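(* Let $G \in \mathcal{H}$ be a $2$-connected graph with vertex bipartition $\{V_{\alpha}(G), V_{\beta}(G)\}$. If $C$ is a minimal subgraph of $G$ determined by a pair of paths which cuts $G$ (that is, $C$ is minimal with respect to inclusion among all subgraphs of $G$ that are determined by some pair of paths which cuts $G$), then any two vertices of $C$ whose degree in $G$ is at least $3$ are of the same type.
   Context: All graphs are finite and simple. $\mathcal{H}$ is the family of all graphs in which every cycle has length congruent to $0$ modulo $4$; every such graph is bipartite. A vertex bipartition $\{V_{\alpha}(G), V_{\beta}(G)\}$ of $G$ is a partition of $V(G)$ into two independent sets; vertices in $V_{\alpha}(G)$ are said to be of type $\alpha$ and vertices in $V_{\beta}(G)$ of type $\beta$. For a path $P$: if $P$ has length at least $2$, then $Int\, P$ denotes the set of all its inner vertices; if $P$ has length $1$, then $Int\, P$ denotes the edge of $P$. The graph $G - (Int\,P \cup Int\,Q)$ is obtained from $G$ by deleting these vertices (with their incident edges), respectively edges. A pair $(P,Q)$ of two (vertex-)disjoint paths in $G$ cuts $G$ if: (a) each of $P$ and $Q$ has all its inner vertices of degree $2$ in $G$, and its two ends are of different types and of degree at least $3$ in $G$; (b) the graph $G - (Int\, P \cup Int\, Q)$ has exactly two components, and each of them contains ends of these paths of the same type (i.e. one component contains the ends of $P$ and $Q$ of type $\alpha$ and the other contains the ends of $P$ and $Q$ of type $\beta$). These two components are called the subgraphs of $G$ determined by $(P,Q)$. *)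

(* Defs.v *)
From mathcomp Require Import all_boot.

Set Implicit Arguments.
Unset Strict Implicit.
Unset Printing Implicit Defensive.

(* A finite simple graph is a symmetric irreflexive relation [e] on a         *)
(* [finType].  Its subgraphs carry an explicit edge set, each edge being the  *)
(* two-element set of its ends, so that single edges can be deleted.          *)

Record subgraph (T : finType) :=
  Subgraph { vset : {set T}; eset : {set {set T}} }.

Section Graphs.

Variables (T : finType) (e : rel T).
Implicit Types (H C : subgraph T) (X A : {set T}) (F : {set {set T}}).
Implicit Types (P Q c : seq T).

Definition whole : subgraph T :=
  Subgraph setT [set [set u.1; u.2] | u : T * T & e u.1 u.2].

Definition adj H : rel T := [rel x y | [set x; y] \in eset H].

Definition subgraph_incl C H : Prop :=
  vset C \subset vset H /\ eset C \subset eset H.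

Definition delete H X F : subgraph T :=
  Subgraph (vset H :\: X) [set f in eset H :\: F | [disjoint f & X]].

Definition connected H : Prop :=
  forall x y, x \in vset H -> y \in vset H -> connect (adj H) x y.

Definition component_sets H : {set {set T}} :=
  equivalence_partition (connect (adj H)) (vset H).

Definition is_component H C : Prop :=
  vset C \in component_sets H /\
  eset C = [set f in eset H | f \subset vset C].

Definition k_connected (k : nat) : Prop :=
  k < #|T| /\
  forall X, #|X| < k -> connected (delete whole X set0).

Definition degree (x : T) : nat := #|[set y | e x y]|.

Definition all_cycles_0mod4 : Prop :=
  forall c, 2 < size c -> ucycle e c -> size c = 0 %[mod 4].

Definition independent A : Prop :=
  forall x y, x \in A -> y \in A -> ~~ e x y.

Definition bipartition (Va Vb : {set T}) : Prop :=
  [/\ Va :|: Vb = setT, [disjoint Va & Vb], independent Va & independent Vb].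

(* A path is listed by its vertices, in either direction; its length is       *)
(* [(size P).-1].                                                             *)
Definition is_path P : Prop :=
  if P is x :: p then path e x p /\ uniq P else False.

Definition ends P : {set T} :=
  if P is x :: p then [set x; last x p] else set0.

Definition inner P : {set T} := [set x in P] :\: ends P.

(* [int_vertices P] and [int_edges P] together are Int P: the inner vertices, *)
(* or the single edge if P has length 1 (in which case [inner P] is empty).   *)
Definition int_vertices P : {set T} := inner P.

Definition int_edges P : {set {set T}} :=
  if size P == 2 then [set ends P] else set0.

Definition delete_ints P Q : subgraph T :=
  delete whole (int_vertices P :|: int_vertices Q)
               (int_edges P :|: int_edges Q).

Definition cut_path (Va Vb : {set T}) P : Prop :=
  [/\ is_path P,
      forall x, x \in inner P -> degree x = 2,
      exists a b, [/\ ends P = [set a; b], a \in Va & b \in Vb]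
    & forall x, x \in ends P -> 2 < degree x].

Definition cuts (Va Vb : {set T}) P Q : Prop :=
  [/\ [disjoint P & Q],
      cut_path Va Vb P,
      cut_path Va Vb Q
    & exists A B : {set T},
        [/\ A != B,
            component_sets (delete_ints P Q) = [set A; B],
            (ends P :|: ends Q) :&: Va \subset A
          & (ends P :|: ends Q) :&: Vb \subset B]].

Definition determined (Va Vb : {set T}) C : Prop :=
  exists P Q, cuts Va Vb P Q /\ is_component (delete_ints P Q) C.

Definition minimal_determined (Va Vb : {set T}) C : Prop :=
  determined Va Vb C /\
  forall C', determined Va Vb C' -> subgraph_incl C' C -> C' = C.

Definition same_type (Va Vb : {set T}) (x y : T) : Prop :=
  (x \in Va /\ y \in Va) \/ (x \in Vb /\ y \in Vb).

End Graphs.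

(* Main.v *)
Require Import Defs.
From mathcomp Require Import all_boot zify.

Set Implicit Arguments.
Unset Strict Implicit.
Unset Printing Implicit Defensive.

(** In a graph whose cycles all have length divisible by 4, an edge set in which
    every vertex has even degree is a disjoint union of cycles, so its size is
    divisible by 4 ([even_edges_dvd4]).  The symmetric difference of two such
    sets is again such a set, hence any two of them share an even number of
    edges ([even_edges_orth]).  All the parity facts about links come from these two.

    Call a vertex of degree at least 3 a branch vertex, and a path whose inner
    vertices have degree 2 and whose ends are branch vertices of different types
    a thread.  The main step is that every thread [R] has a partner [R'] such
    that the two cut the graph ([second_thread]).  Close [R] to a cycle by a path
    with positions [0, ..., n]; here [n] is odd since the ends of [R] have
    different types.  Link two positions when they are joined off the cycle.  By
    orthogonality, linked positions have the same parity, and so do two links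
    that cross each other.  By 2-connectedness the positions of branch vertices
    are those linked to another position.  A purely combinatorial argument on
    such non-crossing families ([uncovered_gap]) yields two consecutive branch
    positions [i < j], [i] even and [j] odd, that no link spans: the segment
    from [i] to [j] is the thread [R'], and deleting [R] and [R'] separates the
    positions up to [i] from those starting at [j].

    Now let [A] be a minimal side of a cutting pair [(P, Q)], containing their
    ends [u] and [u'] of type alpha, and suppose that [A] has a branch vertex of
    type beta.  As [A] is connected, it contains a thread [R] ([thread_in_side]).
    - If the ends of [R] are still joined in [A] after the removal of [R], the
      closing path can be chosen inside [A].  The rest of the graph together
      with [P] and [Q] stays connected off [R] and [R'], so it lies within one of
      the two sides of [(R, R')]; the other side is a proper subset of [A]
      ([nonseparating_thread_absurd]).
    - Otherwise [R] splits [A] into two parts.  Since there is no cut vertex, each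
      part contains one of [u], [u'] and this is not the end of [R] lying in that
      part ([part_has_end]).  Hence [R] together with [P] or with [Q] cuts the
      graph, and one of the two sides lies in one of the parts ([separating_thread_absurd]).
    Both cases contradict minimality.  The side with the ends of type beta is
    handled by exchanging the two colour classes. *)

(** * Non-crossing links between positions *)

Section NoncrossingPositions.

Variables (n : nat) (L : rel nat).
Hypothesis L_sym : symmetric L.
Hypothesis L_odd : forall a b, a <= n -> b <= n -> L a b -> odd a = odd b.
Hypothesis L_cross : forall a a' b b',
  a < a' -> a' < b -> b < b' -> b' <= n -> L a b -> L a' b' -> odd a = odd a'.

Definition attached l := exists l', [/\ l' <= n, l' != l & L l l'].

(** Position [k] stands here for the step from [k] to [k + 1]. *)
Definition covered k := exists a b, [/\ a <= k, k < b, b <= n & L a b].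

(** With [Q := odd] only the links between odd positions count: a run of steps
    covered by these can be followed backwards from its odd right end. *)
Definition coveredb (Q : pred nat) k :=
  [exists a : 'I_n.+1, [exists b : 'I_n.+1, [&& a <= k, k < b, Q a & L a b]]].

Lemma coveredbP (Q : pred nat) k :
  reflect (exists a b, [/\ a <= k, k < b, b <= n, Q a & L a b]) (coveredb Q k).
Proof.
apply: (iffP idP) => [/existsP[a /existsP[b /and4P[ak kb Qa Lab]]]|].
  by exists a, b; split=> //; rewrite -ltnS.
case=> a [b [ak kb bn Qa Lab]]; have an : a < n.+1 by lia.
have bn' : b < n.+1 by [].
by apply/existsP; exists (Ordinal an); apply/existsP; exists (Ordinal bn'); apply/and4P.
Qed.

Definition attachedb l := [exists l' : 'I_n.+1, (l' != l :> nat) && L l l'].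

Lemma attachedP l : reflect (attached l) (attachedb l).
Proof.
apply: (iffP existsP) => [[l' /andP[ne Ll]]|[l' [ln ne Ll]]].
  by exists l'; split; rewrite // -ltnS.
by have ln' : l' < n.+1 by []; exists (Ordinal ln'); apply/andP.
Qed.

(** Start from an odd position [q] where links to the left of it stop, and go back
    as long as the steps are covered by links between odd positions.  The start
    [a] of this run is odd, being an end of such a link.  The step before [a] is
    covered by no link at all: a link between even positions covering it would
    end strictly inside the run, and would cross the odd link covering its end. *)
Lemma odd_cover_start q : q <= n -> odd q -> attached q -> q = n \/ ~ covered q ->
  exists a, [/\ 0 < a <= q, odd a, attached a & ~ covered a.-1].
Proof.
move=> qn oq atq q_end.
have bound a b : a < q -> b <= n -> L a b -> b <= q.
  move=> aq bn Lab; case: q_end => [-> //|ncq]; rewrite leqNgt; apply/negP => qb.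
  by apply: ncq; exists a, b; split=> //; apply: ltnW.
pose P a := [forall k : 'I_n.+1, (a <= k < q) ==> coveredb odd k].
have exP : exists a, P a by exists q; apply/forallP => k; apply/implyP; lia.
case: (ex_minnP exP) => a /forallP Pa min_a.
have cov k : a <= k < q -> coveredb odd k.
  move=> akq; have kn : k < n.+1 by lia.
  by have := Pa (Ordinal kn); rewrite /= akq.
have aq : a <= q by apply: min_a; apply/forallP => k; apply/implyP; lia.
have ncov : 0 < a -> ~~ coveredb odd a.-1.
  move=> a0; apply/negP => c; suff /min_a : P a.-1 by lia.
  apply/forallP => k; apply/implyP => /andP[ak kq].
  have [->|ne] := eqVneq (k : nat) a.-1; first exact: c.
  by apply: cov; lia.
have [oa ata] : odd a /\ attached a.
  have [->//|neq] := eqVneq a q.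
  have /coveredbP[x [y [xa ay yn ox Lxy]]] : coveredb odd a by apply: cov; lia.
  suff -> : a = x by split=> //; exists y; split=> //; lia.
  apply/eqP; rewrite eqn_leq xa andbT leqNgt; apply/negP => xa'.
  have /negP[] : ~~ coveredb odd a.-1 by apply: ncov; lia.
  by apply/coveredbP; exists x, y; split=> //; lia.
have a0 : 0 < a by case: (a) oa.
exists a; split; rewrite ?a0 //.
case=> x [y [xa ay yn Lxy]]; have xodd : ~~ odd x.
  apply/negP => ox; have /negP[] := ncov a0.
  by apply/coveredbP; exists x, y.
have xy := L_odd (leq_trans xa (leq_trans (leq_pred _) (leq_trans aq qn))) yn Lxy.
have yq : y <= q by apply: (@bound x) => //; lia.
have {}yq : y < q by rewrite ltn_neqAle yq andbT; apply: contraNneq xodd => yq';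
  rewrite xy yq'.
have ya : a < y.
  by rewrite ltn_neqAle; apply/andP; split; [apply: contraNneq xodd => ya;
    rewrite xy -ya | lia].
have /coveredbP[x' [y' [x'y yy' y'n ox' Lxy']]] : coveredb odd y by apply: cov; lia.
have nx'y : x' != y by apply: contraNneq xodd => E; rewrite xy -E.
have ax' : a <= x'.
  rewrite leqNgt; apply/negP => x'a; have /negP[] := ncov a0.
  by apply/coveredbP; exists x', y'; split=> //; lia.
have := @L_cross x x' y y'; rewrite ox' => /(_ _ _ _ y'n Lxy Lxy') H.
by apply/negP: xodd; rewrite H //; lia.
Qed.

(** Go down from [n]: the run ending at [q] starts at an odd attached position [j],
    preceded by uncovered steps down to the previous attached position [i].  If
    [i] is even the gap is found; if it is odd, links stop at [i] and the argument
    is repeated there.  The descent ends because position 0 is even. *)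
Lemma uncovered_gap : odd n -> attached 0 -> attached n ->
  exists i j, [/\ i < j <= n, ~~ odd i /\ odd j, attached i /\ attached j,
    forall l, i < l < j -> ~ attached l
  & forall k, i <= k < j -> ~ covered k].
Proof.
move=> on at0 atn.
suff gap q : q <= n -> odd q -> attached q -> q = n \/ ~ covered q ->
    exists i j, [/\ i < j <= n, ~~ odd i /\ odd j, attached i /\ attached j,
      forall l, i < l < j -> ~ attached l
    & forall k, i <= k < j -> ~ covered k].
  by apply: (gap n) => //; left.
elim/ltn_ind: q => q IH qn oq atq q_end.
have [j [/andP[j0 jq] oj atj nj]] := odd_cover_start qn oq atq q_end.
have exI : exists i, attachedb i && (i < j) by exists 0; rewrite j0 andbT; apply/attachedP.
have ubI i : attachedb i && (i < j) -> i <= j by case/andP => _ /ltnW.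
case: (ex_maxnP exI ubI) => i /andP[/attachedP ati ij] max_i.
have no_att l : i < l < j -> ~ attached l.
  by case/andP => il lj /attachedP atl; have := max_i l; rewrite atl lj => /(_ isT); lia.
have unc k : i <= k < j -> ~ covered k.
  move=> /andP[ik kj] [a [b [ak kb bn Lab]]]; apply: nj; exists a, b; split=> //.
    lia.
  have jb : ~ (b < j).
    move=> bj; apply: (@no_att b); first lia.
    by exists a; split; rewrite 1?L_sym //; lia.
  lia.
have [oi|ei] := boolP (odd i); last by exists i, j; split=> //; lia.
apply: (IH i) => //; [lia | lia | right; apply: unc; lia].
Qed.

End NoncrossingPositions.

(** * Symmetric difference of finite sets *)
Section SymmetricDifference.

Variable U : finType.
Implicit Types A B : {set U}.

Definition symdiff A B := (A :\: B) :|: (B :\: A).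

Lemma in_symdiff A B x : (x \in symdiff A B) = (x \in A) (+) (x \in B).
Proof. by rewrite !inE; case: (x \in A); case: (x \in B). Qed.

Lemma card_symdiff A B : #|symdiff A B| + (#|A :&: B|).*2 = #|A| + #|B|.
Proof.
have dis : [disjoint A :\: B & B :\: A].
  by apply/pred0P => x; rewrite !inE; case: (x \in A); case: (x \in B).
rewrite -(cardsID B A) -(cardsID A B) (setIC B A) /symdiff cardsU.
move: dis; rewrite -setI_eq0 => /eqP ->; rewrite cards0 subn0 -addnn.
lia.
Qed.

Lemma odd_symdiff A B : odd #|symdiff A B| = odd #|A| (+) odd #|B|.
Proof. by have /(congr1 odd) := card_symdiff A B; rewrite !oddD odd_double addbF. Qed.

Lemma symdiffIl A B C : symdiff A B :&: C = symdiff (A :&: C) (B :&: C).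
Proof. by apply/setP => x; rewrite !(in_symdiff, inE) andb_addl. Qed.

Lemma disjoint_symdiff A B : [disjoint A & B] -> symdiff A B = A :|: B.
Proof.
move=> /pred0P dis; apply/setP => x; move: (dis x).
by rewrite in_symdiff !inE /=; case: (x \in A); case: (x \in B).
Qed.

Lemma subset_symdiff A B : B \subset A -> symdiff A B = A :\: B.
Proof.
by rewrite -setD_eq0 => /eqP BA; rewrite /symdiff BA setU0.
Qed.

Lemma disjoint_setU A B (C : {set U}) :
  [disjoint A :|: B & C] = [disjoint A & C] && [disjoint B & C].
Proof. by rewrite -!setI_eq0 setIUl setU_eq0. Qed.

End SymmetricDifference.

(** * Even edge sets have size divisible by 4 *)
Section EdgeSets.

Variables (T : finType) (e : rel T).
Hypotheses (e_sym : symmetric e) (e_irr : irreflexive e).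
Implicit Types (D F J : {set {set T}}) (f : {set T}) (x y v : T) (p : seq T).

Lemma eq_pair x y x' y' :
  [set x; y] = [set x'; y'] -> (x = x' /\ y = y') \/ (x = y' /\ y = x').
Proof.
move/setP => E; move: (E x) (E y) (E x') (E y'); rewrite !inE !eqxx ?orbT /=.
move=> /esym/orP[] /eqP -> /esym/orP[] /eqP -> /orP[] /eqP ? /orP[] /eqP ?; subst; auto.
Qed.

Lemma e_neq x y : e x y -> x != y.
Proof. by apply: contraTneq => ->; rewrite e_irr. Qed.

Definition edges := eset (whole e).

Lemma in_edges x y : ([set x; y] \in edges) = e x y.
Proof.
apply/imsetP/idP => [[[a b]] /= |exy].
  by rewrite inE /= => eab /eq_pair[] [-> ->] //; rewrite e_sym.
by exists (x, y); rewrite ?inE.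
Qed.

Lemma edgesP f : reflect (exists x y, f = [set x; y] /\ e x y) (f \in edges).
Proof.
apply: (iffP idP) => [|[x [y [-> exy]]]]; last by rewrite in_edges.
by case/imsetP => [[a b]]; rewrite inE /= => eab ->; exists a, b.
Qed.

Lemma edges_at f v : f \in edges -> v \in f -> exists2 z, f = [set v; z] & e v z.
Proof.
case/edgesP => x [y [-> exy]]; rewrite !inE => /orP[] /eqP ->; first by exists y.
by exists x; rewrite ?(setUC [set x]) // e_sym.
Qed.

Lemma card_edge f : f \in edges -> #|f| = 2.
Proof. by case/edgesP => x [y [-> /e_neq xy]]; rewrite cards2 xy. Qed.

Definition deg F v := #|[set f in F | v \in f]|.

Lemma deg_sub F F' v : F \subset F' -> deg F v <= deg F' v.
Proof.
move=> sFF; apply: subset_leq_card; apply/subsetP => f; rewrite !inE.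
by case/andP => /(subsetP sFF) -> ->.
Qed.

Lemma deg1 f v : deg [set f] v = (v \in f).
Proof.
rewrite /deg; case vf: (v \in f).
  by apply/eqP/cards1P; exists f; apply/setP => g; rewrite !inE; case: eqP => // ->.
by apply/eqP; rewrite cards_eq0; apply/eqP/setP => g; rewrite !inE; case: eqP => // ->.
Qed.

Lemma degU F F' v : [disjoint F & F'] -> deg (F :|: F') v = deg F v + deg F' v.
Proof.
move=> dis; rewrite /deg -[RHS]subn0; set A := [set _ in F | _]; set B := [set _ in F' | _].
suff <- : #|A :&: B| = 0.
  by rewrite -cardsU; congr #|pred_of_set _|; apply/setP => f; rewrite !inE andb_orl.
apply/eqP; rewrite cards_eq0; apply/eqP/setP => f; rewrite !inE.
by have := pred0P dis f => /=; case: (f \in F) => //= ->; rewrite andbF.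
Qed.

Lemma odd_deg_symdiff F F' v :
  odd (deg (symdiff F F') v) = odd (deg F v) (+) odd (deg F' v).
Proof.
rewrite /deg -odd_symdiff; congr (odd #|pred_of_set _|).
by apply/setP => f; rewrite !(in_symdiff, inE) andb_addl.
Qed.

Lemma degree_deg v : degree e v = deg edges v.
Proof.
rewrite /degree /deg -(card_in_imset (f := fun y => [set v; y])) /=; last first.
  by move=> y z _ _ /eq_pair[[]|[-> ->]].
congr #|pred_of_set _|; apply/setP => f; apply/imsetP/idP.
  by case=> y; rewrite !inE => evy ->; rewrite in_edges evy set21.
by rewrite inE => /andP[fE /(edges_at fE)[z -> evz]]; exists z; rewrite ?inE.
Qed.

(** Deleting single edges, rather than vertices, makes all the deletions below
    comparable: removing the interior of a thread amounts to removing its edges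
    ([eset_delete_ints]). *)
Definition avoid D : rel T := [rel x y | e x y && ([set x; y] \notin D)].
Definition con D : rel T := connect (avoid D).

Lemma avoid_sym D : symmetric (avoid D).
Proof. by move=> x y; rewrite /avoid /= e_sym setUC. Qed.

Lemma con_sym D : symmetric (con D).
Proof. exact/sym_connect_sym/avoid_sym. Qed.

Lemma con_trans D : transitive (con D).
Proof. exact: connect_trans. Qed.

Lemma con0 D x : con D x x.
Proof. exact: connect0. Qed.

Lemma con1 D x y : e x y -> [set x; y] \notin D -> con D x y.
Proof. by move=> exy nD; apply: connect1; rewrite /avoid /= exy. Qed.

(** Connectivity is used through closed sets: every separation claim below is
    obtained by exhibiting a set that no allowed edge leaves. *)
Lemma con_closed D (S : {set T}) x y :
    (forall s t, s \in S -> e s t -> [set s; t] \notin D -> t \in S) ->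
  con D x y -> x \in S -> y \in S.
Proof.
move=> cl /connectP[p + ->]; elim: p x => //= z p IH x /andP[/andP[exz nD] pth] xS.
exact/IH/(cl x).
Qed.

Lemma con_sub D D' x y :
    (forall s t, con D x s -> e s t -> [set s; t] \notin D -> [set s; t] \notin D') ->
  con D x y -> con D' x y.
Proof.
move=> sub cxy; suff : y \in [set z | con D x z && con D' x z] by rewrite inE => /andP[].
apply: (con_closed _ cxy); last by rewrite inE !con0.
move=> s t; rewrite !inE => /andP[c1 c2] est nD.
by rewrite (con_trans c1 (con1 est nD)) (con_trans c2 (con1 est _)) // sub.
Qed.

Fixpoint pedges x p : {set {set T}} :=
  if p is y :: p' then [set x; y] |: pedges y p' else set0.

Lemma pedges_sub x p f : f \in pedges x p -> f \subset x :: p.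
Proof.
elim: p x => [|y p IH] x /=; first by rewrite inE.
rewrite !inE => /orP[/eqP ->|/IH /subsetP sub].
  by apply/subsetP => v; rewrite !inE => /orP[] ->; rewrite ?orbT.
by apply/subsetP => v /sub; rewrite !inE => ->; rewrite orbT.
Qed.

Lemma pedges_edges x p : path e x p -> pedges x p \subset edges.
Proof.
elim: p x => [|y p IH] x /=; first by rewrite sub0set.
by case/andP => exy /IH s; rewrite subUset s sub1set in_edges exy.
Qed.

Lemma pedges_fresh x y p : x \notin y :: p -> [set x; y] \notin pedges y p.
Proof.
move=> nx; apply/negP => /pedges_sub /subsetP /(_ x).
by rewrite set21 => /(_ isT); apply/negP.
Qed.

Lemma card_pedges x p : uniq (x :: p) -> #|pedges x p| = size p.
Proof.
elim: p x => [|y p IH] x /=; first by rewrite cards0.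
by case/andP => /pedges_fresh fr u; rewrite cardsU1 fr IH.
Qed.

(** An edge of the path contains [v] when [v] is its first or its second vertex;
    the first vertices are listed by [belast x p], the second ones by [p]. *)
Lemma deg_pedges x p v :
  uniq (x :: p) -> deg (pedges x p) v = (v \in belast x p) + (v \in p).
Proof.
elim: p x => [|y p IH] x.
  by move=> _; rewrite /deg; apply/eqP; rewrite cards_eq0; apply/eqP/setP => f; rewrite !inE.
rewrite cons_uniq => /andP[nx u]; move: (pedges_fresh nx) => fr.
rewrite [pedges _ _]/= degU; last by rewrite disjoints1.
rewrite deg1 IH // /belast -/(belast y p).
rewrite !inE; have xb: x \notin belast y p by apply: contra nx => /mem_belast.
move: nx u; rewrite inE negb_or => /andP[xy nxp] /andP[ny _].
case: (eqVneq v x) => [->|nvx] /=; first by rewrite (negPf xy) (negPf nxp) (negPf xb).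
case: (eqVneq v y) => [->|_] //=.
by rewrite (negPf ny) addn0 addnC.
Qed.

Lemma odd_deg_pedges x p v :
  uniq (x :: p) -> odd (deg (pedges x p) v) = (v == x) (+) (v == last x p).
Proof.
move=> u; rewrite deg_pedges //.
have ub : uniq (belast x p) by move: u; rewrite lastI rcons_uniq => /andP[].
have up : uniq p by case/andP: u.
have := congr1 (count_mem v) (lastI x p).
rewrite -cats1 count_cat /= !count_uniq_mem // addn0 => E.
rewrite oddD !oddb ![v == _]eq_sym.
move/(congr1 odd): E; rewrite !oddD !oddb.
by case: (v \in p); case: (v \in belast _ _); case: (x == v); case: (last x p == v).
Qed.

(** Walking from [x] to [y] and adding the edges modulo 2 gives an edge set whose
    only odd degrees are at [x] and [y] (none if [x = y]); the walk may repeat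
    vertices and edges.  The last clause makes the sets obtained in different
    components disjoint. *)
Lemma con_join D x y : con D x y -> exists J,
  [/\ J \subset edges, [disjoint J & D],
      forall v, odd (deg J v) = (v == x) (+) (v == y)
    & forall f v, f \in J -> v \in f -> con D x v].
Proof.
case/connectP => p + ->; elim: p x => [|z p IH] x /=.
  exists set0; split; first exact: sub0set.
  - by apply/pred0P => f; rewrite /= inE.
  - by move=> v; rewrite addbb /deg; apply/negbTE; rewrite
      (_ : [set _ in _ | _] = set0) ?cards0 //; apply/setP => f; rewrite !inE.
  by move=> f v; rewrite inE.
case/andP => /andP[exz nD] /IH[J [sJ dJ oJ cJ]].
exists (symdiff [set [set x; z]] J); split.
- by rewrite subUset !(subset_trans (subsetDl _ _)) // sub1set in_edges.
- apply/pred0P => f; rewrite /= in_symdiff inE; case: eqP => [->|_].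
    by rewrite (negPf nD) andbF.
  by have := pred0P dJ f.
- move=> v; rewrite odd_deg_symdiff oJ deg1 !inE oddb.
  have := e_neq exz; case: (eqVneq v x) => [->|_] /= nxz; last by rewrite addKb.
  by rewrite (negPf nxz).
move=> f v; rewrite in_symdiff inE; case: eqP => [-> _|_ /= fJ vf].
  rewrite !inE => /orP[] /eqP ->; first exact: con0.
  exact: con1.
exact: con_trans (con1 exz nD) (cJ f v fJ vf).
Qed.

Lemma handshake F (S : {set T}) :
    F \subset edges -> (forall f, f \in F -> f \subset S \/ [disjoint f & S]) ->
  ~~ odd (\sum_(v in S) deg F v).
Proof.
move=> sF cl; have -> : \sum_(v in S) deg F v = \sum_(f in F) #|f :&: S|.
  under eq_bigr => v _ do rewrite /deg -sum1dep_card big_mkcondr /=.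
  rewrite exchange_big /=; apply: eq_bigr => f _.
  rewrite -big_mkcondr /= sum1dep_card; apply: eq_card => v.
  by rewrite !inE andbC.
apply: (big_ind (fun n => ~~ odd n)) => // [m n|f fF].
  by rewrite oddD => /negPf -> /negPf ->.
case: (cl f fF) => [/setIidPl ->|].
  by rewrite card_edge // (subsetP sF).
by rewrite -setI_eq0 => /eqP ->; rewrite cards0.
Qed.

(** Conversely, by the handshake identity on the [F]-component of [x], the other
    vertex of odd degree lies in the same component. *)
Lemma join_con F x y :
    F \subset edges -> (forall v, odd (deg F v) = (v == x) (+) (v == y)) ->
  con (~: F) x y.
Proof.
move=> sF oF; apply/negP => /negP nxy; pose S := [set z | con (~: F) x z].
have neq : x != y by apply: contraNneq nxy => ->; apply: con0.
have xS : x \in S by rewrite inE con0.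
have /negP[] : ~~ odd (\sum_(v in S) deg F v).
  apply: handshake => // f fF; have [v vf|] := pickP [pred v | v \in f & v \in S]; last first.
    by move=> no; right; apply/pred0P => v; rewrite /= -[RHS](no v).
  left; case/andP: vf => vf vS; have fE := subsetP sF f fF.
  have [z fz evz] := edges_at fE vf; rewrite fz; apply/subsetP => t.
  rewrite inE => /orP[] /set1P -> //; move: vS; rewrite !inE => /con_trans; apply.
  by apply: con1 => //; rewrite -fz inE negbK.
rewrite (big_morph odd oddD (erefl : odd 0 = false)) (bigD1 x) //= oF eqxx (negPf neq).
rewrite big1 // => v /andP[vS /negPf nvx]; rewrite oF nvx.
by case: (eqVneq v y) vS => // ->; rewrite inE (negPf nxy).
Qed.

Definition even_edges F := F \subset edges /\ forall v, ~~ odd (deg F v).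

Lemma even_symdiff F F' : even_edges F -> even_edges F' -> even_edges (symdiff F F').
Proof.
move=> [sF oF] [sF' oF']; split.
  by rewrite subUset !(subset_trans (subsetDl _ _)).
by move=> v; rewrite odd_deg_symdiff (negPf (oF v)) (negPf (oF' v)).
Qed.

Hypothesis e_H : all_cycles_0mod4 e.

(** Peel off cycles: for an edge [xy] of [F], the set [F] minus [xy] has odd degree
    exactly at [x] and [y], so a path in it closes [xy] to a cycle inside [F]. *)
Lemma even_edges_dvd4 F : even_edges F -> 4 %| #|F|.
Proof.
have [n] := ubnP #|F|; elim: n F => // n IH F le_n [sF oF].
have [-> | [f fF]] := set_0Vmem F; first by rewrite cards0.
have [x [y [fE exy]]] := edgesP _ (subsetP sF f fF).
pose F' := F :\ f.
have dF' : F' = symdiff F [set f] by rewrite subset_symdiff ?sub1set.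
have /connectP[p0 pth0 lst0] : con (~: F') x y.
  apply: join_con; first exact: subset_trans (subD1set _ _) sF.
  move=> v; rewrite dF' odd_deg_symdiff (negPf (oF v)) deg1 fE !inE oddb /=.
  by have := e_neq exy; case: (eqVneq v x) => [->|] /=; [move/negPf=> -> | move=> _ _;
    case: eqVneq].
case/shortenP: pth0 lst0 => p pth u _ lst.
have pF' : pedges x p \subset F'.
  elim: p x pth {exy fE lst u} => [|z p IHp] x /=; first by rewrite sub0set.
  case/andP => /andP[_]; rewrite inE negbK => xz /IHp s.
  by rewrite subUset sub1set xz.
have pthe : path e x p by apply: sub_path pth => a b /andP[].
have fp : f \notin pedges x p.
  by apply/negP => /(subsetP pF'); rewrite !inE eqxx.
have szc : size (x :: p) = 0 %[mod 4].
  apply: e_H; last by rewrite /ucycle u /= rcons_path pthe -lst e_sym exy.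
  case: p lst fp {pth u pF' pthe} => [|z [|z' p]] //= E; last first.
    by rewrite fE E !inE eqxx.
  by rewrite E e_irr in exy.
(* The cycle through [f]. *)
pose C := f |: pedges x p.
have dC : C = symdiff [set f] (pedges x p) by rewrite disjoint_symdiff // disjoints1.
have cC : #|C| = size (x :: p) by rewrite cardsU1 fp card_pedges.
have sC : C \subset F by rewrite subUset sub1set fF (subset_trans pF') ?subD1set.
have eC : even_edges C.
  split; first exact: subset_trans sF.
  move=> v; rewrite dC odd_deg_symdiff deg1 fE odd_deg_pedges // -lst !inE oddb.
  by have := e_neq exy; case: (eqVneq v x) => [->|] /=; [move/negPf=> -> | move=> _ _;
    case: eqVneq].
have : even_edges (F :\: C) by rewrite -subset_symdiff //; apply: even_symdiff.
move/IH; rewrite cardsD (setIidPr sC); have := subset_leq_card sC.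
rewrite cC => leC H; rewrite -(subnK leC) dvdn_addl ?H //.
  by clear -le_n leC; move: le_n leC => /=; lia.
by rewrite /dvdn szc.
Qed.

(** The symmetric difference has size [#|F| + #|F'| - 2 #|F :&: F'|], and all
    three sets have size divisible by 4. *)
Lemma even_edges_orth F F' : even_edges F -> even_edges F' -> ~~ odd #|F :&: F'|.
Proof.
move=> eF eF'; have := card_symdiff F F'.
have /dvdnP[a ->] := even_edges_dvd4 (even_symdiff eF eF').
have /dvdnP[b ->] := even_edges_dvd4 eF.
have /dvdnP[c ->] := even_edges_dvd4 eF'.
set m := #|_| => E; have : 4 %| a * 4 + m.*2 by rewrite E -mulnDl dvdn_mull.
rewrite dvdn_addr ?dvdn_mull // -muln2 (_ : 4 = 2 * 2) // dvdn_pmul2r //.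
by rewrite dvdn2.
Qed.

(** * Paths given by positions *)
Implicit Types (w : nat -> T).

(** A path with vertices [w 0, ..., w n].  The parity arguments compare positions, so
    the vertices of a path and of its segments are named by their positions. *)
Definition wpath w n :=
  (forall k, k < n -> e (w k) (w k.+1)) /\
  (forall k l, k <= n -> l <= n -> w k = w l -> k = l).

Definition wseg w i j := [seq w k | k <- iota i.+1 (j - i)].
Definition wedges w i j := pedges (w i) (wseg w i j).

Lemma wseg_cons w i j : w i :: wseg w i j = [seq w k | k <- iota i (j - i).+1].
Proof. by []. Qed.

Lemma mem_wseg_cons w i j v : i <= j ->
  reflect (exists2 k, i <= k <= j & v = w k) (v \in w i :: wseg w i j).
Proof.
move=> ij; rewrite wseg_cons; apply: (iffP mapP) => -[k].
  by rewrite mem_iota => ? ->; exists k => //; lia.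
by move=> ? ->; exists k; rewrite // mem_iota; lia.
Qed.

Lemma last_wseg w i j : i <= j -> last (w i) (wseg w i j) = w j.
Proof.
move=> ij; rewrite /wseg last_map -[in RHS](subnKC ij); congr w.
move: (j - i) => m {ij}; elim: m i => [|m IH] i /=; first by rewrite addn0.
by rewrite IH addSnnS.
Qed.

Lemma wedgesP w i j f : i <= j ->
  reflect (exists2 k, i <= k < j & f = [set w k; w k.+1]) (f \in wedges w i j).
Proof.
move=> ij; rewrite /wedges /wseg; move: (subnKC ij); move: (j - i) => m <- {ij}.
elim: m i => [|m IH] i /=.
  by rewrite inE; constructor => -[k]; lia.
rewrite !inE; apply: (iffP orP) => [[/eqP ->|/IH[k kb ->]]|[k kb fE]].
- by exists i => //; lia.
- by exists k => //; lia.
have [ki|ne] := eqVneq k i; [by left; rewrite fE ki | right].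
by apply/IH; exists k => //; lia.
Qed.

Section Positions.

Variables (w : nat -> T) (n : nat).
Hypothesis wp : wpath w n.

Lemma wseg_path i j : i <= j <= n -> path e (w i) (wseg w i j).
Proof.
case: wp => we _ /andP[ij jn]; rewrite /wseg.
have : i + (j - i) <= n by lia.
move: (j - i) => m {ij}; elim: m i => //= m IH i mn; rewrite we ?IH //; lia.
Qed.

Lemma wseg_uniq i j : i <= j <= n -> uniq (w i :: wseg w i j).
Proof.
case: wp => _ winj ijn; rewrite wseg_cons map_inj_in_uniq ?iota_uniq // => k l.
rewrite !mem_iota => kb lb; apply: winj; lia.
Qed.

Lemma card_wedges i j : i <= j <= n -> #|wedges w i j| = j - i.
Proof. by move=> ijn; rewrite card_pedges ?wseg_uniq // size_map size_iota. Qed.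

Lemma wedges_edges i j : i <= j <= n -> wedges w i j \subset edges.
Proof. by move=> ijn; rewrite pedges_edges // wseg_path. Qed.

Lemma odd_deg_wedges i j v :
  i <= j <= n -> odd (deg (wedges w i j) v) = (v == w i) (+) (v == w j).
Proof.
by move=> /[dup] /andP[ij _] ijn; rewrite odd_deg_pedges ?wseg_uniq // last_wseg.
Qed.

Lemma w_eq k l : k <= n -> l <= n -> (w k == w l) = (k == l).
Proof. by move=> kn ln; apply/eqP/eqP => [|-> //]; apply: (proj2 wp). Qed.

Lemma wedge_inj k l : k < n -> l < n ->
  [set w k; w k.+1] = [set w l; w l.+1] -> k = l.
Proof.
case: wp => _ winj kn ln /eq_pair[] [E E']; first by apply: winj E; lia.
by move: (winj _ _ (ltnW kn) ln E) (winj _ _ kn (ltnW ln) E'); lia.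
Qed.

Lemma wedge_in i j k : i <= j <= n -> k < n ->
  ([set w k; w k.+1] \in wedges w i j) = (i <= k < j).
Proof.
move=> /[dup] /andP[ij _] ijn kn; apply/wedgesP/idP => // [[l lb /wedge_inj]|kb];
  last by exists k.
by move=> ->; lia.
Qed.

Lemma deg_wedges i j k : i <= j <= n -> k <= n ->
  deg (wedges w i j) (w k) = (i <= k < j) + (i < k <= j).
Proof.
case: wp => _ winj ijn kn; rewrite deg_pedges ?wseg_uniq //; congr (_ + _).
  have -> : belast (w i) (wseg w i j) = [seq w k | k <- iota i (j - i)].
    rewrite /wseg belast_map; congr map; move: (j - i) => m {ijn}.
    by elim: m i => //= m IH i; rewrite IH.
  congr nat_of_bool; apply/mapP/idP => [[l]|kb].
    by rewrite mem_iota => lb /winj; lia.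
  by exists k; rewrite // mem_iota; lia.
congr nat_of_bool; apply/mapP/idP => [[l]|kb].
  by rewrite mem_iota => lb /winj; lia.
by exists k; rewrite // mem_iota; lia.
Qed.

End Positions.

Lemma con_wpath D x y : con D x y -> exists w n,
  [/\ wpath w n, w 0 = x, w n = y & forall k, k < n -> [set w k; w k.+1] \notin D].
Proof.
case/connectP => p0 pth0 lst0; case/shortenP: pth0 lst0 => p pth u _ ->.
have stp k : k < size p -> avoid D (nth x (x :: p) k) (nth x (x :: p) k.+1).
  exact: (pathP x pth).
exists (nth x (x :: p)), (size p); split=> //.
- split=> [k /stp /andP[] //|k l kn ln /eqP].
  by rewrite nth_uniq // => /eqP.
- by rewrite (last_nth x).
- by move=> k /stp /andP[].
Qed.

(** * Links off a cycle *)

(** The intersection pairing modulo 2, bilinear for the symmetric difference. *)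
Definition odd_meet F F' := odd #|F :&: F'|.

Lemma odd_meetC F F' : odd_meet F F' = odd_meet F' F.
Proof. by rewrite /odd_meet setIC. Qed.

Lemma odd_meetDl F1 F2 F : odd_meet (symdiff F1 F2) F = odd_meet F1 F (+) odd_meet F2 F.
Proof. by rewrite /odd_meet symdiffIl odd_symdiff. Qed.

Lemma odd_meetDr F1 F2 F : odd_meet F (symdiff F1 F2) = odd_meet F F1 (+) odd_meet F F2.
Proof. by rewrite odd_meetC odd_meetDl !(odd_meetC F). Qed.

Lemma odd_meet_disjoint F F' : [disjoint F & F'] -> odd_meet F F' = false.
Proof. by rewrite -setI_eq0 /odd_meet => /eqP ->; rewrite cards0. Qed.

(** In this part [R] is an edge set with the odd degrees of a path between the ends of
    [w], which makes [K] an even set; for the edges of such a path, [K] is a cycle. *)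
Section Links.

Variables (w : nat -> T) (n : nat) (R : {set {set T}}).
Hypotheses (wp : wpath w n) (sR : R \subset edges).
Hypothesis oR : forall v, odd (deg R v) = (v == w 0) (+) (v == w n).
Hypothesis dR : forall k, k < n -> [set w k; w k.+1] \notin R.

Let K := R :|: wedges w 0 n.
Let link k l := con K (w k) (w l).

Lemma wedges_disjoint_R i j : i <= j <= n -> [disjoint R & wedges w i j].
Proof.
move=> /[dup] ijn /andP[ij jn]; apply/pred0P => f /=; apply/negP => /andP[fR /wedgesP].
case=> // k kb fE; move: fR; rewrite fE (negPf (dR _)) //.
by case/andP: kb => _ /leq_trans; apply.
Qed.

Lemma even_cycle : even_edges K.
Proof.
have n0 : 0 <= n <= n by rewrite leqnn.
rewrite /K -disjoint_symdiff ?wedges_disjoint_R //; split.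
  by rewrite subUset !(subset_trans (subsetDl _ _)) // (wedges_edges wp).
by move=> v; rewrite odd_deg_symdiff oR (odd_deg_wedges wp) // addbb.
Qed.

Lemma odd_meet_wedges i j i' j' : i <= j <= n -> i' <= j' <= n ->
  odd_meet (wedges w i j) (wedges w i' j') = odd (minn j j' - maxn i i').
Proof.
move=> ijn ijn'; have -> : odd_meet (wedges w i j) (wedges w i' j') =
    odd #|wedges w (maxn i i') (maxn (maxn i i') (minn j j'))|.
  congr (odd #|pred_of_set _|); apply/setP => f; rewrite inE; apply/andP/idP.
    case=> /wedgesP[|k kb ->]; first by lia.
    by move=> fw; rewrite (wedge_in wp) //; rewrite (wedge_in wp) // in fw; lia.
  case/wedgesP => [|k kb ->]; first by lia.
  by rewrite !(wedge_in wp) //; lia.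
by rewrite (card_wedges wp) //; [congr odd; lia | lia].
Qed.

Lemma join_disjoint i j J : [disjoint J & K] -> i <= j <= n -> [disjoint J & wedges w i j].
Proof.
move=> dJ ijn; apply: disjointWr dJ; apply/subsetP => f; rewrite inE => /wedgesP.
by case=> [|k kb ->]; [lia | rewrite (wedge_in wp) //; lia].
Qed.

(** An ear [J] between two positions closes up with the segment between them. *)
Lemma even_ear i j J : i <= j <= n -> J \subset edges ->
    (forall v, odd (deg J v) = (v == w i) (+) (v == w j)) ->
  even_edges (symdiff J (wedges w i j)).
Proof.
move=> ijn sJ oJ; split; first by rewrite subUset !(subset_trans (subsetDl _ _)) //
  (wedges_edges wp).
by move=> v; rewrite odd_deg_symdiff oJ (odd_deg_wedges wp) // addbb.
Qed.

(** The cycle formed by the ear and the segment from [k] to [l] meets [K] exactly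
    in the [l - k] edges of the segment. *)
Lemma link_odd_lt k l : k <= l -> l <= n -> link k l -> odd k = odd l.
Proof.
move=> kl ln /con_join[J [sJ dJ oJ _]]; have kln : k <= l <= n by lia.
have := even_edges_orth (even_ear kln sJ oJ) even_cycle.
rewrite -/(odd_meet _ _) odd_meetDl (odd_meet_disjoint dJ) /K.
have n0 : 0 <= n <= n by rewrite leqnn.
rewrite -disjoint_symdiff ?wedges_disjoint_R // odd_meetDr odd_meet_wedges //.
rewrite [odd_meet _ R]odd_meetC odd_meet_disjoint ?wedges_disjoint_R //= => H.
have : ~~ odd (l - k) by move: H; rewrite (_ : _ - _ = l - k) //; lia.
by rewrite oddB // negb_add => /eqP.
Qed.

Lemma link_sym : symmetric link.
Proof. by move=> k l; apply: con_sym. Qed.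

Lemma link_odd k l : k <= n -> l <= n -> link k l -> odd k = odd l.
Proof.
move=> kn ln; case: (leqP k l) => [kl|/ltnW lk]; first exact: link_odd_lt.
by rewrite link_sym => /link_odd_lt ->.
Qed.

(** Let [J] and [J'] be ears joining [i] to [j] and [i'] to [j'].  If they touch, all
    four positions are linked.  Otherwise [J] and [J'] with the segments [i, i'] and
    [j, j'] form an even set, which shares [J] and the segment [i, i'] with the
    cycle formed by [J] and the segment [i, j].  As [j - i] is even, so is the
    size of [J], and therefore [i' - i]. *)
Lemma link_cross i i' j j' : i < i' -> i' < j -> j < j' -> j' <= n ->
  link i j -> link i' j' -> odd i = odd i'.
Proof.
move=> ii' i'j jj' j'n.
have [b1 b2 b3 b4] : [/\ i <= i' <= n, i' <= j' <= n, i <= j <= n & j <= j' <= n].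
  by split; lia.
have E1 : minn i' j - maxn i i = i' - i by lia.
have E2 : minn j' j - maxn j i = 0 by lia.
have ij : i <= j by lia.
move=> lij lij'.
have [[i_n i'_n] [j_n j'_n]] : (i <= n /\ i' <= n) /\ (j <= n /\ j' <= n)
  by clear -b1 b2 b3 b4; lia.
have [lii'|nlii'] := boolP (link i i'); first by apply: link_odd.
have oij : odd i = odd j by apply: link_odd.
have oij' : odd i' = odd j' by apply: link_odd.
have [J [sJ dJ oJ cJ]] := con_join lij; have [J' [sJ' dJ' oJ' cJ']] := con_join lij'.
have dJJ' : [disjoint J' & J].
  apply/pred0P => f /=; apply/negP => /andP[fJ' fJ].
  have [x [y [fE _]]] := edgesP _ (subsetP sJ f fJ).
  have xf : x \in f by rewrite fE set21.
  move/negP: nlii'; apply; apply: con_trans (cJ f x fJ xf) _.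
  by rewrite con_sym; apply: cJ' xf.
pose S k l := wedges w k l.
pose F := symdiff (symdiff J (S i i')) (symdiff J' (S j j')).
have eF : even_edges F.
  split; first by rewrite !(subUset, subset_trans (subsetDl _ _)) // (wedges_edges wp).
  move=> v; rewrite !odd_deg_symdiff oJ oJ' !(odd_deg_wedges wp) //.
  by case: (v == w i); case: (v == w i'); case: (v == w j); case: (v == w j').
have eE := even_ear b3 sJ oJ.
have := even_edges_orth eF eE; rewrite -/(odd_meet _ _) !(odd_meetDl, odd_meetDr)
  !odd_meet_wedges //.
rewrite ![odd_meet (wedges _ _ _) J]odd_meetC !(odd_meet_disjoint (join_disjoint dJ _)) //.
rewrite (odd_meet_disjoint dJJ') (odd_meet_disjoint (join_disjoint dJ' _)) //.
have -> : odd_meet J J = false.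
  have := even_edges_dvd4 eE; rewrite disjoint_symdiff ?join_disjoint //.
  have := join_disjoint dJ b3; rewrite -setI_eq0 cardsU => /eqP ->.
  rewrite cards0 subn0 (card_wedges wp) // /odd_meet setIid => d4.
  have : ~~ odd (#|J| + (j - i)) by rewrite -dvdn2; apply: dvdn_trans d4.
  by rewrite oddD oddB // oij addbb addbF => /negPf.
by rewrite E1 E2 /= !addbF oddB ?(ltnW ii') // negb_add => /eqP.
Qed.

End Links.

(** * Threads and the pairs that cut the graph *)
Hypothesis e_2conn : k_connected e 2.
Implicit Types (P Q R : seq T).

Lemma in_eset_delete (X : {set T}) F f :
  (f \in eset (delete (whole e) X F)) = [&& f \in edges, f \notin F & [disjoint f & X]].
Proof. by rewrite [LHS]inE in_setD -/edges andbA; congr (_ && _); rewrite andbC. Qed.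

Lemma connected_whole x y : con set0 x y.
Proof.
case: e_2conn => _ /(_ set0); rewrite cards0 => /(_ isT x y);
  rewrite /= !in_setD !in_setT !in_set0 => /(_ isT isT); apply: connect_sub => s t.
rewrite [adj _ _ _]in_eset_delete in_edges => /and3P[est _ _].
by apply: con1; rewrite ?inE.
Qed.

Lemma no_cutvertex a (S : {set T}) x y : x \in S -> x != a -> y \notin S -> y != a ->
  exists s t, [/\ s \in S, t \notin S, s != a, t != a & e s t].
Proof.
move=> xS xa yS ya.
have [/existsP[s /existsP[t /and5P[]]]|no] := boolP [exists s, [exists t,
    [&& s \in S, t \notin S, s != a, t != a & e s t]]]; first by exists s, t.
case/negP: yS; case: e_2conn => _ /(_ [set a]); rewrite cards1 => /(_ isT x y).
rewrite /= !in_setD !in_setT !in_set1 !andbT => /(_ xa ya) /connectP[p].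
elim: p x xS {xa} => [|z p IH] x xS /= => [_ -> //|/andP[xz pth]]; apply: IH pth.
apply: contraNT no => zS; move: xz;
  rewrite [adj _ _ _]in_eset_delete in_edges => /and3P[xzE _].
rewrite disjoints_subset => /subsetP sub; have := sub x; have := sub z.
rewrite !inE !eqxx orbT => /(_ isT) za /(_ isT) xa.
by apply/existsP; exists x; apply/existsP; exists z; rewrite xS zS xa za.
Qed.

Variables (Va Vb : {set T}).
Hypothesis e_bip : bipartition e Va Vb.

Lemma notVa x : (x \notin Va) = (x \in Vb).
Proof.
case: e_bip => /setP/(_ x) U /pred0P/(_ x) /= D _ _; move: U D; rewrite !inE.
by case: (x \in Va); case: (x \in Vb).
Qed.

Lemma e_type x y : e x y -> (x \in Va) = (y \notin Va).
Proof.
move=> exy; case: e_bip => _ _ iA iB.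
have := iA x y; have := iB x y; rewrite exy -!notVa.
by case: (x \in Va); case: (y \in Va) => //= a b; [have := b isT isT | have := a isT isT].
Qed.

(** The edges of a path given, as in a pair that cuts the graph, by a bare list. *)
Definition pedge P := if P is x :: p then pedges x p else set0.

Notation cutp := (cut_path e Va Vb).

Lemma cutp_ends P : cutp P -> exists a b,
  [/\ ends P = [set a; b], a \in Va, b \in Vb, 2 < degree e a & 2 < degree e b].
Proof.
case=> _ _ [a [b [E aV bV]]] br; exists a, b; split=> //; apply: br; rewrite E.
  exact: set21.
exact: set22.
Qed.

Lemma ends_sub P x : x \in ends P -> x \in P.
Proof. by case: P => [|y p] /=; rewrite !inE // => /orP[] /eqP -> //;
  [rewrite eqxx | apply: mem_last]. Qed.

Lemma mem_innerP P x : (x \in inner P) = (x \in P) && (x \notin ends P).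
Proof. by rewrite !inE andbC. Qed.

Lemma pedge_edges P : cutp P -> pedge P \subset edges.
Proof. by case: P => [[]//|x p [[pth _] _ _ _]]; apply: pedges_edges. Qed.

Lemma pedge_sub P f : f \in pedge P -> f \subset P.
Proof. by case: P => [|x p]; [rewrite inE | apply: pedges_sub]. Qed.

Lemma cutp_neq x p : cutp (x :: p) -> x != last x p.
Proof.
case=> _ _ [a [b [/= E aV bV]]] _; have ab : a != b.
  by apply: contraTneq bV => <-; rewrite -notVa negbK.
apply: contra_neq ab => xl; move: E; rewrite -xl => /setP E.
have := E a; have := E b; rewrite !inE !eqxx ?orbT !orbb.
by move=> /eqP -> /eqP ->.
Qed.

Lemma deg_end P x : cutp P -> x \in ends P -> deg (pedge P) x = 1.
Proof.
case: P => [[]//|y p] cp; have nyl := cutp_neq cp; case: cp => [[_ u] _ _ _].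
have pl : last y p \in p by case: (p) nyl => //= [|z q]; [rewrite eqxx | rewrite mem_last].
have ub : last y p \notin belast y p by move: u; rewrite lastI rcons_uniq => /andP[].
have yp : y \notin p by case/andP: u.
rewrite /= !inE deg_pedges // => /orP[] /eqP ->; last by rewrite pl (negPf ub).
rewrite (negPf yp); have := mem_head y p; rewrite lastI mem_rcons inE (negPf nyl) /=.
by move=> ->.
Qed.

Lemma deg_out P x : is_path e P -> x \notin P -> deg (pedge P) x = 0.
Proof.
case: P => [//|y p [_ u] nx]; rewrite deg_pedges //.
have -> : x \in belast y p = false by apply: contraNF nx => /mem_belast.
by have -> : x \in p = false by apply: contraNF nx => xp; rewrite inE xp orbT.
Qed.

(** An inner vertex has degree 2 and already lies on two edges of the path. *)
Lemma inner_edge P x f : cutp P -> x \in inner P -> f \in edges -> x \in f -> f \in pedge P.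
Proof.
move=> cp xi fE xf; have sP := pedge_edges cp; case: cp => isP /(_ x xi) dx _ _.
suff /setP/(_ f) : [set g in pedge P | x \in g] = [set g in edges | x \in g].
  by rewrite !inE fE xf andbT.
apply/eqP; rewrite eqEcard; apply/andP; split.
  by apply/subsetP => g; rewrite !inE => /andP[/(subsetP sP) -> ->].
rewrite -/(deg edges x) -degree_deg dx; case: P isP xi {sP} => // y p [_ u].
rewrite mem_innerP /= !inE => /andP[xP]; rewrite negb_or => /andP[xy xl].
rewrite -/(deg _ x) deg_pedges //; move: (xP); rewrite (negPf xy) /= => ->.
by move: xP; rewrite -in_cons lastI mem_rcons inE (negPf xl) /= => ->.
Qed.

Lemma path_con D x p z : path e x p -> [disjoint pedges x p & D] -> z \in x :: p -> con D x z.
Proof.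
elim: p x => [|y p IH] x /=; first by rewrite inE => _ _ /eqP ->; apply: con0.
case/andP => exy pth; rewrite disjoint_setU disjoints1 => /andP[nD dis].
rewrite inE => /orP[/eqP ->|zp]; first exact: con0.
exact: con_trans (con1 exy nD) (IH _ pth dis zp).
Qed.

Lemma cutp_con D P x y : cutp P -> [disjoint pedge P & D] -> x \in P -> y \in P -> con D x y.
Proof.
case: P => // a p [[pth _] _ _ _] dis xP yP.
by apply: con_trans (path_con pth dis yP); rewrite con_sym; apply: path_con dis xP.
Qed.

Lemma con_not_inner D P x y : cutp P -> pedge P \subset D -> x \notin inner P ->
  con D x y -> y \notin inner P.
Proof.
move=> cp sD nx cxy; rewrite -in_setC; apply: con_closed cxy _; last by rewrite in_setC.
move=> s t _ est nD; rewrite in_setC; apply: contra nD => ti.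
apply: (subsetP sD); apply: (inner_edge cp ti); first by rewrite in_edges.
exact: set22.
Qed.

(** Used to recognise the edge of a path of length 1: any other edge of a path
    has an inner vertex of the path as an end. *)
Lemma pedges_ends x p f : path e x p -> uniq (x :: p) -> f \in pedges x p ->
  f \subset [set x; last x p] -> size p = 1.
Proof.
case: p => [|y p]; first by rewrite inE.
rewrite [pedges _ _]/= => /andP[exy pth] /andP[nx u]; rewrite !inE => /orP[/eqP ->|fp] sub.
  have := subsetP sub y; rewrite set22 => /(_ isT);
    rewrite !inE eq_sym (negPf (e_neq exy)) /=.
  case: p u {pth nx sub} => //= z p /andP[ny _] /eqP E.
  by move: ny; rewrite [X in X \notin _]E mem_last.
have fE := subsetP (pedges_edges pth) f fp.
have : f \subset [set last y p].
  apply/subsetP => v vf; have := subsetP sub v vf; rewrite !inE => /orP[/eqP vx|//].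
  by case/negP: nx; rewrite -vx (subsetP (pedges_sub fp)).
by move/subset_leq_card; rewrite cards1 (card_edge fE).
Qed.

Lemma pedge_deleted P f : cutp P -> f \in edges ->
  (f \in pedge P) = (f \in int_edges P) || ~~ [disjoint f & int_vertices P].
Proof.
move=> cp fE; apply/idP/orP => [fP|[]].
- have [dis|] := boolP [disjoint f & int_vertices P]; [left | by right].
  have sub : f \subset ends P.
    apply/subsetP => v vf; have vP := subsetP (pedge_sub fP) v vf.
    have := pred0P dis v; rewrite /= vf mem_innerP vP /=.
    by move/negbT; rewrite negbK.
  case: P cp fP sub {dis} => // x p [[pth u] _ _ _] fP sub.
  have := pedges_ends pth u fP sub; rewrite /int_edges /=.
  by case: p {pth u sub} fP => // y [|//] /=; rewrite !inE orbF => ->.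
- rewrite /int_edges; case: P {cp} => [|x [|y [|]]] //=; by rewrite ?inE ?orbF.
rewrite -setI_eq0 => /set0Pn[v]; rewrite !inE => /and3P[vf ne vP].
by apply: (inner_edge cp) vf; rewrite // !inE ne.
Qed.

Definition cedges P Q := pedge P :|: pedge Q.

(** Both conventions for the interior of a path, vertices for length at least 2
    and the edge itself for length 1, remove precisely the edges of the path. *)
Lemma eset_delete_ints P Q : cutp P -> cutp Q ->
  eset (delete_ints e P Q) = edges :\: cedges P Q.
Proof.
move=> cP cQ; apply/setP => f; rewrite in_eset_delete !inE.
have [fE|] := boolP (f \in edges); last by rewrite !andbF.
rewrite (pedge_deleted cP fE) (pedge_deleted cQ fE) andbT.
rewrite [[disjoint f & _ :|: _]]disjoint_sym disjoint_setU ![[disjoint int_vertices _ & f]]disjoint_sym.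
by do 4 case: (_ \in _) || case: [disjoint _ & _].
Qed.

Lemma connect_delete_ints P Q : cutp P -> cutp Q ->
  connect (adj (delete_ints e P Q)) =2 con (cedges P Q).
Proof.
move=> cP cQ; apply: eq_connect => x y.
have -> : adj (delete_ints e P Q) x y = ([set x; y] \in eset (delete_ints e P Q)) by [].
by rewrite eset_delete_ints // in_setD in_edges andbC.
Qed.

Lemma vset_delete_ints P Q x : (x \in vset (delete_ints e P Q)) = (x \notin inner P)
  && (x \notin inner Q).
Proof. by rewrite /= in_setD in_setU in_setT andbT negb_or. Qed.

(** For [x] not inner to [P] or [Q] this is a component of the graph without their
    interiors: inner vertices are isolated once the edges are removed. *)
Definition side P Q x := [set y | con (cedges P Q) x y].

Lemma sideE P Q x : cutp P -> cutp Q -> x \in vset (delete_ints e P Q) ->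
  [set y in vset (delete_ints e P Q) | connect (adj (delete_ints e P Q)) x y] = side P Q x.
Proof.
move=> cP cQ; rewrite vset_delete_ints => /andP[xP xQ]; apply/setP => y.
rewrite [LHS]in_set [RHS]in_set vset_delete_ints connect_delete_ints //;
  apply: andb_idl => cxy.
apply/andP; split; [apply: con_not_inner cP _ xP cxy | apply: con_not_inner cQ _ xQ cxy].
  exact: subsetUl.
exact: subsetUr.
Qed.

Lemma component_setsP P Q A : cutp P -> cutp Q ->
  reflect (exists2 x, x \in vset (delete_ints e P Q) & A = side P Q x)
          (A \in component_sets (delete_ints e P Q)).
Proof.
move=> cP cQ; apply: (iffP imsetP) => -[x xV ->]; exists x => //;
  [exact: sideE | exact/esym/sideE].
Qed.

Lemma side_eq P Q x y : con (cedges P Q) x y -> side P Q x = side P Q y.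
Proof.
move=> cxy; apply/setP => z; rewrite !inE; apply/idP/idP; last exact: con_trans.
by apply: con_trans; rewrite con_sym.
Qed.

Lemma cuts_sides P Q : cuts e Va Vb P Q -> exists u v u' v',
  [/\ [/\ ends P = [set u; v], ends Q = [set u';
    v'], u \in Va, u' \in Va & v \in Vb /\ v' \in Vb],
      con (cedges P Q) u u', con (cedges P Q) v v', ~~ con (cedges P Q) u v
    & component_sets (delete_ints e P Q) = [set side P Q u; side P Q v]].
Proof.
case=> _ cP cQ [A [B [AB comp sA sB]]].
have [u [v [EP uV vV _ _]]] := cutp_ends cP; have [u' [v' [EQ u'V v'V _ _]]] := cutp_ends cQ.
have uA : u \in A by apply: (subsetP sA); rewrite !inE EP !inE eqxx uV.
have u'A : u' \in A by apply: (subsetP sA); rewrite !inE EQ !inE eqxx u'V orbT.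
have vB : v \in B by apply: (subsetP sB); rewrite !inE EP !inE eqxx vV orbT.
have v'B : v' \in B by apply: (subsetP sB); rewrite !inE EQ !inE eqxx v'V !orbT.
have cls C x : C \in [set A; B] -> x \in C -> C = side P Q x.
  rewrite -comp => /(component_setsP _ cP cQ)[y yV ->]; rewrite inE; exact: side_eq.
have EA := cls A u (set21 _ _) uA; have EB := cls B v (set22 _ _) vB.
exists u, v, u', v'; split=> //.
- by move: u'A; rewrite EA inE.
- by move: v'B; rewrite EB inE.
- by apply: contraNN AB => /side_eq; rewrite EA EB => ->.
by rewrite -EA -EB.
Qed.

Lemma end_not_inner P x : x \in ends P -> x \notin inner P.
Proof. by rewrite mem_innerP => ->; rewrite andbF. Qed.

Lemma disjoint_not_inner P Q x : [disjoint P & Q] -> x \in P -> x \notin inner Q.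
Proof. by move=> /pred0P/(_ x) /= D xP; rewrite mem_innerP; move: D; rewrite xP /= => ->. Qed.

(** A vertex from which no end can be reached would have a component that no edge
    leaves, against the connectedness of the whole graph. *)
Lemma reach_end P Q x : cutp P -> cutp Q -> x \notin inner P -> x \notin inner Q ->
  exists2 t, t \in ends P :|: ends Q & con (cedges P Q) x t.
Proof.
move=> cP cQ xP xQ; have [u [v [EP _ _ _ _]]] := cutp_ends cP.
have [t|no] := pickP [pred t | (t \in ends P :|: ends Q) && con (cedges P Q) x t].
  by case/andP; exists t.
exists u; first by rewrite EP !inE eqxx.
suff : u \in side P Q x by rewrite inE.
apply: con_closed (connected_whole x u) _; last by rewrite inE con0.
move=> s t; rewrite !inE => cs est _; have [D|nD] := boolP ([set s; t] \in cedges P Q);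
  last first.
  exact: con_trans cs (con1 est nD).
have := no s; rewrite /= cs andbT.
have nP := con_not_inner cP (subsetUl _ _) xP cs.
have nQ := con_not_inner cQ (subsetUr _ _) xQ cs.
move: nP nQ; rewrite !mem_innerP !inE; move: D;
  rewrite inE => /orP[] /pedge_sub/subsetP/(_ s);
  by rewrite set21 => /(_ isT) -> /=; rewrite ?negbK => h1 h2; rewrite ?h1 ?h2 ?orbT.
Qed.

(** Two of the four ends on each side are enough: by [reach_end] there can be no
    third component. *)
Lemma cutsI P Q u v u' v' : cutp P -> cutp Q -> [disjoint P & Q] ->
    ends P = [set u; v] -> ends Q = [set u'; v'] ->
    u \in Va -> u' \in Va -> v \in Vb -> v' \in Vb ->
    con (cedges P Q) u u' -> con (cedges P Q) v v' -> ~~ con (cedges P Q) u v ->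
  cuts e Va Vb P Q /\ component_sets (delete_ints e P Q) = [set side P Q u; side P Q v].
Proof.
move=> cP cQ dis EP EQ uV u'V vV v'V uu' vv' uv.
have uP : u \in ends P by rewrite EP set21. have vP : v \in ends P by rewrite EP set22.
have inV x : x \in ends P -> x \in vset (delete_ints e P Q).
  by move=> xP; rewrite vset_delete_ints end_not_inner // (disjoint_not_inner dis) //
    ends_sub.
have comp : component_sets (delete_ints e P Q) = [set side P Q u; side P Q v].
  apply/setP => A; apply/(component_setsP _ cP cQ)/set2P => [[x + ->]|]; last first.
    by case=> ->; [exists u | exists v] => //; apply: inV.
  rewrite vset_delete_ints => /andP[xP xQ]; have [t] := reach_end cP cQ xP xQ.
  rewrite EP EQ !inE -!orbA => /or4P[] /eqP -> /side_eq ->; auto.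
    by left; apply/esym/side_eq.
  by right; apply/esym/side_eq.
split=> //; split=> //; exists (side P Q u), (side P Q v); split=> //.
- by apply/eqP => /setP/(_ v); rewrite !inE con0 (negPf uv).
- apply/subsetP => x; rewrite EP EQ !inE -!orbA => /andP[/or4P[] /eqP -> //];
  rewrite ?con0 //.
    by rewrite -notVa in vV; rewrite (negPf vV).
  by rewrite -notVa in v'V; rewrite (negPf v'V).
apply/subsetP => x; rewrite EP EQ !inE -!orbA => /andP[/or4P[] /eqP -> //]; rewrite ?con0 //.
  by rewrite -notVa uV.
by rewrite -notVa u'V.
Qed.

Lemma wseg_cut_path w n i j : wpath w n -> i < j <= n -> w i \in Va -> w j \in Vb ->
    2 < degree e (w i) -> 2 < degree e (w j) ->
    (forall k, i < k < j -> ~~ (2 < degree e (w k))) ->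
  ends (w i :: wseg w i j) = [set w i; w j] /\ cutp (w i :: wseg w i j).
Proof.
move=> wp ijn iV jV di dj dk; have [ij ijn'] : i <= j /\ i <= j <= n by clear -ijn; lia.
have E : ends (w i :: wseg w i j) = [set w i; w j] by rewrite /= last_wseg.
split=> //; split; rewrite ?E.
- by split; [apply: wseg_path ijn' | apply: wseg_uniq ijn'].
- move=> x; rewrite mem_innerP E => /andP[/mem_wseg_cons[//|k kb ->]] nE.
  have {}kb : i < k < j.
    move: nE; rewrite !inE negb_or => /andP[n1 n2].
    have : k != i by apply: contraNneq n1 => ->.
    have : k != j by apply: contraNneq n2 => ->.
    by clear -kb; lia.
  have kn : k <= n by clear -kb ijn'; lia.
  have := deg_sub (w k) (wedges_edges wp ijn'); rewrite -degree_deg (deg_wedges wp) //.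
  by have := dk k kb; clear -kb; lia.
- by exists (w i), (w j).
by move=> x; rewrite !inE => /orP[] /eqP ->.
Qed.

Lemma wpath_type w n k : wpath w n -> w 0 \in Va -> k <= n -> (w k \in Va) = ~~ odd k.
Proof.
case=> we _ w0; elim: k => [|k IH] kn; first by rewrite w0.
by have := e_type (we k kn); rewrite IH /=; [case: odd; case: (_ \in _) | apply: ltnW].
Qed.

(** * Every thread has a partner *)
Section SecondThread.

Variables (w : nat -> T) (n : nat) (R : seq T).
Hypotheses (wp : wpath w n) (cR : cutp R) (ER : ends R = [set w 0; w n]).
Hypotheses (w0V : w 0 \in Va) (wnV : w n \in Vb).
Hypothesis dR : forall k, k < n -> [set w k; w k.+1] \notin pedge R.

Let K := pedge R :|: wedges w 0 n.
Let link k l := con K (w k) (w l).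

Lemma odd_deg_pedge v : odd (deg (pedge R) v) = (v == w 0) (+) (v == w n).
Proof.
case: R cR ER => [[]//|x p] [[_ u] _ _ _] /= /eq_pair[] [<- <-];
  by rewrite odd_deg_pedges // addbC.
Qed.

Lemma odd_n : odd n.
Proof. by rewrite -[odd n]negbK -(wpath_type wp w0V) // notVa. Qed.

Lemma n_gt0 : 0 < n.
Proof. by case: n odd_n. Qed.

Lemma w_not_inner k : k <= n -> w k \notin inner R.
Proof.
case: wp => we _ kn; apply/negP => ki; have n0 := n_gt0.
have [kn'|nk] := ltnP k n.
  by case/negP: (dR kn'); apply: (inner_edge cR ki); rewrite ?in_edges ?we ?set21.
have kn' : k.-1 < n by clear -kn nk n0; lia.
have kE : k = k.-1.+1 by clear -kn nk n0; lia.
by case/negP: (dR kn'); apply: (inner_edge cR ki); rewrite ?in_edges ?we // -?kE ?set22.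
Qed.

Lemma w_in_R k : k <= n -> (w k \in R) = (k == 0) || (k == n).
Proof.
move=> kn; have := w_not_inner kn; rewrite mem_innerP ER !inE !(w_eq wp) //.
case: (boolP (w k \in R)) => [_|/negP nR _]; first by rewrite negbK.
apply/esym/negP => kE; apply: nR; apply: ends_sub; rewrite ER !inE.
by case/orP: kE => /eqP ->; rewrite eqxx ?orbT.
Qed.

Lemma deg_cycle k : k <= n -> deg K (w k) = 2.
Proof.
move=> kn; rewrite degU; last by apply: (wedges_disjoint_R dR); rewrite leqnn.
rewrite (deg_wedges wp) ?leqnn //; have [kR|kR] := boolP (w k \in R).
  rewrite deg_end //; last by rewrite -[_ \in _]negbK; move: (w_not_inner kn);
    rewrite mem_innerP kR.
  by move: kR; rewrite w_in_R //; have := n_gt0; clear -kn; lia.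
rewrite deg_out //; last by case: cR.
by move: kR; rewrite w_in_R //; have := n_gt0; clear -kn; lia.
Qed.

Lemma cycle_edges : K \subset edges.
Proof. by rewrite subUset pedge_edges ?(wedges_edges wp) ?leqnn. Qed.

Lemma degree_cycle k : k <= n -> degree e (w k) = 2 + deg (edges :\: K) (w k).
Proof.
move=> kn; rewrite degree_deg -(deg_cycle kn) -degU.
  by congr deg; rewrite setDE setUIr setUCr setIT; apply/esym/setUidPr/cycle_edges.
by rewrite -setI_eq0 setDE setICA setICr setI0.
Qed.

(** A branch vertex [w k] has an edge off the cycle.  If what hangs on it were
    joined off the cycle to no other position, [w k] would be a cut vertex. *)
Lemma branch_attached k : k <= n -> 2 < degree e (w k) -> attached n link k.
Proof.
move=> kn; rewrite degree_cycle // -[X in X < _]addn0 ltn_add2l => /card_gt0P[f].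
rewrite inE => /andP[/setDP[fE fK] kf]; have [z fz ekz] := edges_at fE kf.
case: (attachedP n link k) => // nat_k; exfalso.
pose S := [set v | con K (w k) v].
have [l [ln lk]] : exists l, l <= n /\ l != k.
  have n0 := n_gt0; case: (posnP k) => [->|k0]; first by exists n; rewrite -lt0n.
  by exists 0; rewrite eq_sym -lt0n.
have zS : z \in S by rewrite inE con1 // -fz.
have zk : z != w k by rewrite eq_sym e_neq.
have lS : w l \notin S by rewrite inE; apply/negP => kl; apply: nat_k; exists l.
have lkw : w l != w k by rewrite (w_eq wp).
have [s [t [sS tS sk _ est]]] := no_cutvertex zS zk lS lkw.
have stK : [set s; t] \in K.
  apply: contraNT tS => nK; rewrite inE in sS; rewrite inE.
  exact: con_trans sS (con1 est nK).
have noS l' : l' <= n -> s <> w l'.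
  move=> ln' sl; apply: nat_k; exists l'; split=> //; last by move: sS; rewrite inE sl.
  by apply: contra_neq sk => <-.
move: stK; rewrite inE => /orP[/pedge_sub/subsetP/(_ s)|/wedgesP[//|l' lb /setP/(_ s)]].
  rewrite set21 => /(_ isT) sR.
  have : s \notin inner R.
    apply: (@con_not_inner K _ (w k)); rewrite ?subsetUl ?w_not_inner //.
    by move: sS; rewrite inE.
  rewrite mem_innerP sR /= negbK ER !inE => /orP[] /eqP; exact: noS.
rewrite set21 !inE => /esym/orP[] /eqP; apply: noS; clear -lb; lia.
Qed.

Lemma attached_branch k : k <= n -> attached n link k -> 2 < degree e (w k).
Proof.
move=> kn [l [ln lk /connectP[p]]]; rewrite degree_cycle // -[X in X < _]addn0 ltn_add2l.
case: p => [_ /eqP|z p /= /andP[/andP[ekz nK] _] _]; first by rewrite (w_eq wp) // (negPf lk).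
by apply/card_gt0P; exists [set w k; z]; rewrite inE in_setD nK in_edges ekz set21.
Qed.

Lemma end_branch k : k = 0 \/ k = n -> attached n link k.
Proof.
move=> kE; have kn : k <= n by case: kE => ->.
apply: branch_attached => //; case: cR => _ _ _; apply; rewrite ER !inE.
by case: kE => ->; rewrite eqxx ?orbT.
Qed.

(** The gap from [uncovered_gap] is the partner.  It avoids the ends of [R]: these
    are branch vertices, so the first and the last step of [w] are covered. *)
Lemma second_thread : exists i j, [/\ i < j <= n, cuts e Va Vb R (w i :: wseg w i j)
  & component_sets (delete_ints e R (w i :: wseg w i j)) =
    [set side R (w i :: wseg w i j) (w 0); side R (w i :: wseg w i j) (w n)]].
Proof.
have sR := pedge_edges cR; have oR := odd_deg_pedge.
have lsym : symmetric link by apply: link_sym.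
have lodd a b : a <= n -> b <= n -> link a b -> odd a = odd b by apply: link_odd.
have lcross a a' b b' : a < a' -> a' < b -> b < b' -> b' <= n -> link a b -> link a' b' ->
    odd a = odd a' by apply: link_cross.
have [i [j [ijn [ei oj] [ati atj] no_att unc]]] := uncovered_gap lsym lodd lcross odd_n
  (end_branch (or_introl erefl)) (end_branch (or_intror erefl)).
have [[ij ijn'] [i_n j_n]] : (i <= j /\ i <= j <= n) /\ i <= n /\ j <= n by clear -ijn; lia.
have iV : w i \in Va by rewrite (wpath_type wp).
have jV : w j \in Vb by rewrite -notVa (wpath_type wp) // oj.
have [ER' cR'] : ends (w i :: wseg w i j) = [set w i; w j] /\ cutp (w i :: wseg w i j).
  apply: (wseg_cut_path wp ijn iV jV); try exact: attached_branch.
  move=> k kb; apply/negP => /branch_attached; have kn : k <= n by clear -kb ijn; lia.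
  by move=> /(_ kn); apply: no_att.
have i0 : 0 < i.
  rewrite lt0n; apply/eqP => i0; have [l [ln l0 L0]] := end_branch (or_introl (erefl 0)).
  apply: (unc i); first by rewrite leqnn; case/andP: ijn.
  by exists 0, l; rewrite i0; split=> //; rewrite lt0n.
have jn : j < n.
  rewrite ltn_neqAle j_n andbT; apply/eqP => jn.
  have [l [ln l0 L0]] := end_branch (or_intror (erefl n)).
  have jb : i <= j.-1 < j by clear -ijn; lia.
  apply: (unc j.-1) => //; exists l, n; split; rewrite 1?lsym //.
    by clear -jn ln l0; lia.
  by clear -jn jb; lia.
have dis : [disjoint R & w i :: wseg w i j].
  apply/pred0P => x /=; apply/negP => /andP[xR /mem_wseg_cons[//|k kb xk]].
  have kn : k <= n by clear -kb j_n; lia.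
  by move: xR; rewrite xk w_in_R //; clear -kb i0 jn; lia.
have avoid_side k : k < n -> ~~ (i <= k < j) ->
    con (cedges R (w i :: wseg w i j)) (w k) (w k.+1).
  move=> kn nk; apply: con1; first by case: wp => + _; apply.
  by rewrite inE negb_or dR //= -/(wedges w i j) (wedge_in wp).
have run k m : k <= m <= n -> (m <= i) || (j <= k) -> con (cedges R (w i :: wseg w i j))
  (w k) (w m).
  move=> kmn mik; have kmE : m = k + (m - k) by clear -kmn; lia.
  have : k + (m - k) <= n by clear -kmn; lia.
  have : (k + (m - k) <= i) || (j <= k) by rewrite -kmE.
  rewrite [in con _ _ _]kmE; move: (m - k) => d {kmn mik kmE}.
  elim: d => [|d IH] h1 h2; first by rewrite addn0 con0.
  rewrite addnS in h1 h2 *; apply: con_trans (IH _ _) (avoid_side _ _ _); clear -h1 h2; lia.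
exists i, j.
have [] // := @cutsI R (w i :: wseg w i j) (w 0) (w n) (w i) (w j)
  cR cR' dis ER ER' w0V iV wnV jV.
- by apply: run; [clear -i_n; lia | rewrite leqnn].
- by rewrite con_sym; apply: run; [clear -j_n; lia | rewrite leqnn orbT].
(* What hangs off the cycle on the positions up to [i] is closed: leaving it would
   need a link spanning the gap. *)
pose S := [set v | [exists k : 'I_i.+1, con K (w k) v]].
have inS v : reflect (exists2 k, k <= i & con K (w k) v) (v \in S).
  rewrite inE; apply: (iffP existsP) => [[k kv]|[k ki kv]].
    by exists k; rewrite // -ltnS.
  by rewrite -ltnS in ki; exists (Ordinal ki).
apply/negP => c0n; have /inS[k ki] : w n \in S.
  apply: con_closed c0n _; last by apply/inS; exists 0; rewrite ?con0.
  move=> s t /inS[k ki cks] est; rewrite inE negb_or => /andP[nR nR'].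
  have [stK|nK] := boolP ([set s; t] \in K); last first.
    by apply/inS; exists k => //; apply: con_trans cks (con1 est nK).
  move: stK; rewrite inE (negPf nR) /= => /wedgesP[//|l ln stE].
  have {}ln : l < n by [].
  move: nR'; rewrite /= -/(wedges w i j) stE (wedge_in wp) // => lij.
  have stl x : x \in [set s; t] -> exists2 m, l <= m <= l.+1 & x = w m.
    by rewrite stE => /set2P[] ->; [exists l | exists l.+1] => //; clear; lia.
  have [[m mb sm] [m' mb' tm']] := (stl s (set21 _ _), stl t (set22 _ _)).
  have [li|il] := ltnP l i.
    by apply/inS; exists m'; [clear -mb' li; lia | rewrite tm' con0].
  have jl : j <= l by clear -lij il; lia.
  case: (unc i); first by rewrite leqnn; case/andP: ijn.
  exists k, m; split=> //; [clear -ijn jl mb; lia | clear -mb ln; lia | by rewrite /link -sm].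
move=> kn; apply: (unc i); first by rewrite leqnn; case/andP: ijn.
by exists k, n; split=> //; clear -ijn; lia.
Qed.

End SecondThread.

(** * A minimal side has branch vertices of one type only *)
Lemma con_mono D D' x y : D' \subset D -> con D x y -> con D' x y.
Proof. by move=> sD; apply: con_sub => s t _ _; apply: contra => /(subsetP sD). Qed.

Lemma degU_le F F' x : deg (F :|: F') x <= deg F x + deg F' x.
Proof.
apply: leq_trans (leq_card_setU _ _); apply: subset_leq_card; apply/subsetP => f.
by rewrite !inE andb_orl.
Qed.

Lemma cuts_neq P Q (X Y : {set T}) :
  cuts e Va Vb P Q -> component_sets (delete_ints e P Q) = [set X; Y] -> X != Y.
Proof.
case=> _ _ _ [A [B [AB -> _ _]]] E; apply: contra_neq AB => XY; move: E.
rewrite XY setUid => /setP E; have := E A; have := E B; rewrite !inE !eqxx orbT /=.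
by move=> /esym/eqP -> /esym/eqP ->.
Qed.

(** Minimality among sides as vertex sets; the edges of a determined subgraph
    follow its vertices, see [minimal_side_minimal]. *)
Definition side_minimal (A : {set T}) := forall P Q (X : {set T}),
  cuts e Va Vb P Q -> X \in component_sets (delete_ints e P Q) -> X \subset A -> X = A.

Section MinimalSide.

Variables (P Q : seq T) (u v u' v' : T).
Hypotheses (cP : cutp P) (cQ : cutp Q) (dis : [disjoint P & Q]).
Hypotheses (EP : ends P = [set u; v]) (EQ : ends Q = [set u'; v']).
Hypotheses (uV : u \in Va) (vV : v \in Vb) (u'V : u' \in Va) (v'V : v' \in Vb).
Let D := cedges P Q.
Hypotheses (uu' : con D u u') (vv' : con D v v') (nuv : ~~ con D u v).
Let A := side P Q u.
Let B := side P Q v.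

Lemma end_P : [/\ u \in P, v \in P, u \notin inner P & v \notin inner P].
Proof.
have uP : u \in ends P by rewrite EP set21. have vP : v \in ends P by rewrite EP set22.
by split; rewrite ?end_not_inner ?ends_sub.
Qed.

Lemma end_Q : [/\ u' \in Q, v' \in Q, u' \notin inner Q & v' \notin inner Q].
Proof.
have uP : u' \in ends Q by rewrite EQ set21. have vP : v' \in ends Q by rewrite EQ set22.
by split; rewrite ?end_not_inner ?ends_sub.
Qed.

Lemma side_P x : x \in A -> x \in P -> x = u.
Proof.
rewrite inE => cux xP; have [_ _ uI _] := end_P.
have := con_not_inner cP (subsetUl _ _) uI cux; rewrite mem_innerP xP /= negbK EP.
by case/set2P => // xv; move: nuv; rewrite -xv cux.
Qed.

Lemma side_Q x : x \in A -> x \in Q -> x = u'.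
Proof.
rewrite inE => cux xQ; have [_ _ uI _] := end_Q.
have cux' : con D u' x by apply: con_trans cux; rewrite con_sym.
have := con_not_inner cQ (subsetUr _ _) uI cux'; rewrite mem_innerP xQ /= negbK EQ.
case/set2P => // xv; move: nuv; rewrite (con_trans cux) // xv con_sym.
exact: vv'.
Qed.

Lemma sides_disjoint x : x \in A -> x \in B -> False.
Proof.
rewrite !inE => cu cv; case/negP: nuv; apply: con_trans cu _; by rewrite con_sym.
Qed.

Lemma off_side x : x \notin A -> [|| x \in B, x \in P | x \in Q].
Proof.
have [_ _|nP] := boolP (x \in P); first by rewrite orbT.
have [_ _|nQ xA] := boolP (x \in Q); first by rewrite !orbT.
have nI R : x \notin R -> x \notin inner R by rewrite mem_innerP => /negPf ->.
have [t] := reach_end cP cQ (nI _ nP) (nI _ nQ); rewrite EP EQ con_sym => tE ctx.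
suff : (x \in A) || (x \in B) by rewrite (negPf xA) /= => ->.
move: tE; rewrite !inE -!orbA => /or4P[] /eqP tE; rewrite tE in ctx.
- by rewrite ctx.
- by rewrite ctx orbT.
- by rewrite (con_trans uu' ctx).
by rewrite (con_trans vv' ctx) orbT.
Qed.

(** Edges deleted inside [A] do not disconnect the opposite side. *)
Lemma other_side_con D' x : (forall f, f \in D' -> f \notin D -> f \subset A) ->
  x \in B -> con D' v x.
Proof.
move=> sD; rewrite inE; apply: con_sub => s t cvs est; apply: contra => fD'.
apply: contraT => /(sD _ fD') /subsetP/(_ s); rewrite set21 => /(_ isT) sA.
by case: (sides_disjoint sA); rewrite inE.
Qed.

(** Walk inside [A] from [u] to the offending vertex and stop at the first branch
    vertex of the other type; the thread runs to it from the last branch vertex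
    before it. *)
Lemma thread_in_side y : y \in A -> 2 < degree e y -> y \notin Va ->
  exists R a b, [/\ cutp R, ends R = [set a; b], a \in Va /\ b \in Vb,
    R \subset A & [disjoint pedge R & D]].
Proof.
rewrite inE => /con_wpath[w [n [wp w0 wn nD]]] dy yV.
have du : 2 < degree e u by case: cP => _ _ _; apply; rewrite EP set21.
(* [j] is the first branch vertex of the wrong type, [i] the branch vertex before it. *)
pose bad k := [&& k <= n, 2 < degree e (w k) & w k \notin Va].
have exbad : exists k, bad k by exists n; rewrite /bad leqnn wn dy.
case: (ex_minnP exbad) => j /and3P[jn dj jV] min_j.
have j0 : 0 < j by rewrite lt0n; apply: contraNneq jV => ->; rewrite w0.
pose good k := (k < j) && (2 < degree e (w k)).
have exgood : exists k, good k by exists 0; rewrite /good j0 w0.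
have ubgood k : good k -> k <= j by case/andP => /ltnW.
case: (ex_maxnP exgood ubgood) => i /andP[ij di] max_i.
have iV : w i \in Va.
  apply: contraT => niV; have := min_j i.
  by rewrite /bad di niV (leq_trans (ltnW ij)) //= leqNgt ij => /(_ isT).
have jV' : w j \in Vb by rewrite -notVa.
have ijn : i < j <= n by rewrite ij.
have no_branch k : i < k < j -> ~~ (2 < degree e (w k)).
  case/andP=> ik kj; apply/negP => dk; have := max_i k; rewrite /good kj dk.
  by move=> /(_ isT); rewrite leqNgt ik.
have [ER cR] := wseg_cut_path wp ijn iV jV' di dj no_branch.
exists (w i :: wseg w i j), (w i), (w j); split=> //.
  apply/subsetP => x /mem_wseg_cons[|k kb ->]; first exact: ltnW.
  have kn : k <= n by clear -kb jn; lia.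
  rewrite inE -w0; elim: k kn {kb} => [_|k IH kn]; first exact: con0.
  by apply: con_trans (IH (ltnW kn)) (con1 _ (nD k kn)); case: wp => + _; apply.
apply/pred0P => f /=; apply/negP => /andP[/wedgesP[|k kb ->]]; first exact: ltnW.
by apply/negP/nD; clear -kb jn; lia.
Qed.

Section Thread.

Variables (R : seq T) (a b : T).
Hypotheses (cR : cutp R) (ER : ends R = [set a; b]) (aV : a \in Va) (bV : b \in Vb).
Hypotheses (RA : R \subset A) (dR : [disjoint pedge R & D]).

Let D2 := D :|: pedge R.

Lemma pedge_R_side f : f \in pedge R -> f \subset A.
Proof. by move=> fR; apply: subset_trans (pedge_sub fR) RA. Qed.

Lemma end_R : [/\ a \in R, b \in R, a \notin inner R & b \notin inner R].
Proof.
have uP : a \in ends R by rewrite ER set21. have vP : b \in ends R by rewrite ER set22.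
by split; rewrite ?end_not_inner ?ends_sub.
Qed.

(** The closing path of [R] is taken inside [A], hence so is its partner [R'].  All
    vertices outside [A] are then joined to [u] off [R] and [R'], through [P], the
    opposite side and [Q].  So the side of [(R, R')] without [u] lies within [A],
    and it is not [A] because it misses [u]. *)
Lemma nonseparating_thread_absurd : side_minimal A -> con D2 a b -> False.
Proof.
move=> minA /con_wpath[w [n [wp w0 wn nD2]]].
have [aR bR _ _] := end_R.
have nR k : k < n -> [set w k; w k.+1] \notin pedge R.
  by move/nD2; rewrite inE negb_or => /andP[].
have nD k : k < n -> [set w k; w k.+1] \notin D.
  by move/nD2; rewrite inE negb_or => /andP[].
have ER' : ends R = [set w 0; w n] by rewrite w0 wn.
have w0V : w 0 \in Va by rewrite w0. have wnV : w n \in Vb by rewrite wn.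
have [i [j [ijn cut comp]]] := second_thread wp cR ER' w0V wnV nR.
have ij : i <= j by clear -ijn; lia.
have wA k : k <= n -> w k \in A.
  elim: k => [_|k IH kn]; first by rewrite w0 (subsetP RA).
  move: (IH (ltnW kn)); rewrite !inE => /con_trans; apply; apply: con1 (nD k kn).
  by case: wp => + _; apply.
set R' := _ :: _ in cut comp; set D' := cedges R R'.
have R'edge f : f \in pedge R' -> f \notin D /\ f \subset A.
  case/wedgesP => // k kb ->; have kn : k < n by clear -kb ijn; lia.
  by split; [apply: nD | rewrite subUset !sub1set !wA // ltnW].
have sub_side f : f \in D' -> f \subset A.
  by rewrite inE => /orP[/pedge_R_side // | /R'edge[]].
have D'D f : f \in D' -> f \notin D.
  rewrite inE => /orP[fR|/R'edge[] //]; apply/negP => fD.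
  by have := pred0P dR f; rewrite /= fR fD.
have disP : [disjoint pedge P & D'].
  by apply/pred0P => f /=; apply/negP => /andP[fP /D'D]; rewrite inE fP.
have disQ : [disjoint pedge Q & D'].
  by apply/pred0P => f /=; apply/negP => /andP[fQ /D'D]; rewrite inE fQ orbT.
have conB x : x \in B -> con D' v x by apply: other_side_con => f /sub_side.
have [uP vP _ _] := end_P; have [u'Q v'Q _ _] := end_Q.
have off x : x \notin A -> con D' u x.
  move=> /off_side/or3P[xB|xP|xQ].
  - exact: con_trans (cutp_con cP disP uP vP) (conB x xB).
  - exact: cutp_con cP disP uP xP.
  apply: con_trans (cutp_con cP disP uP vP) _.
  apply: con_trans (conB v' _) (cutp_con cQ disQ v'Q xQ).
  by rewrite inE.
(* A side of [(R, R')] that misses [u] contradicts minimality. *)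
have bad t : side R R' t \in component_sets (delete_ints e R R') -> ~~ con D' t u -> False.
  move=> tC ntu; have sA : side R R' t = A.
    apply: (minA R R') => //; apply/subsetP => x; rewrite inE => ctx.
    apply: contraT => /off; rewrite con_sym => cxu.
    by case/negP: ntu; apply: con_trans ctx cxu.
  by case/negP: ntu; have : u \in A; [rewrite inE con0 | rewrite -sA inE].
have [cu|] := boolP (con D' (w 0) u); last by apply: bad; rewrite comp set21.
have [cu'|] := boolP (con D' (w n) u); last by apply: bad; rewrite comp set22.
have /eqP[] := cuts_neq cut comp; apply: side_eq; apply: con_trans cu _.
by rewrite con_sym.
Qed.

(** The parts into which [R] splits [A], one for each end of [R]. *)
Definition part t := [set x | con D2 t x].

Lemma part_sub t : t \in R -> part t \subset A.
Proof.
move=> tR; apply/subsetP => x; rewrite !inE => ctx.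
have := subsetP RA t tR; rewrite inE => /con_trans; apply.
by apply: con_mono ctx; apply: subsetUl.
Qed.

(** Edges leave the part of [t] only through [u], [u'] or [t].  If no end of [P] or
    [Q] other than [t] itself were in it, all of them would start at [t].  At most
    two edges at [t] lie on [P], [Q] and [R], as [P] and [Q] are disjoint; the third
    edge at [t] enters the part, so [t] would be a cut vertex. *)
Lemma part_has_end t o : ends R = [set t; o] -> ~~ con D2 t o ->
  exists s, [/\ s = u \/ s = u', s \in part t & s != t].
Proof.
move=> ERt nto; have tE : t \in ends R by rewrite ERt set21.
have oE : o \in ends R by rewrite ERt set22.
have tR := ends_sub tE; have sA := part_sub tR.
have tI := end_not_inner tE; have tS : t \in part t by rewrite inE con0.
have dt : 2 < degree e t by case: cR => _ _ _; apply.
have deg2 : deg D2 t <= 2.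
  apply: leq_trans (degU_le _ _ _) _; rewrite (deg_end cR tE) (addn1 _) ltnS.
  apply: leq_trans (degU_le _ _ _) _; have tA := subsetP sA t tS.
  have [uP _ _ _] := end_P; have [u'Q _ _ _] := end_Q.
  have [tP|tP] := boolP (t \in P); last first.
    rewrite (deg_out (P := P)) //; last by case: cP.
    have [tQ|tQ] := boolP (t \in Q); last by rewrite deg_out //; case: cQ.
    by rewrite (side_Q tA tQ) deg_end // EQ set21.
  have tQ : t \notin Q by apply/negP => tQ; have := pred0P dis t; rewrite /= tP tQ.
  rewrite (deg_out (P := Q)) //; last by case: cQ.
  by rewrite (side_P tA tP) deg_end // EP set21.
have [g gE gD] : exists2 g, g \in edges & (t \in g) && (g \notin D2).
  have /subsetPn[g] : ~~ ([set g in edges | t \in g] \subset [set g in D2 | t \in g]).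
    apply: contraL dt => /subset_leq_card; rewrite degree_deg -leqNgt => le.
    exact: leq_trans le deg2.
  by rewrite in_set => /andP[gE tg]; rewrite in_set tg andbT => gD; exists g; rewrite // tg.
have {gD} [tg gD] := andP gD; have [z gz etz] := edges_at gE tg.
have zS : z \in part t by rewrite inE con1 // -gz.
have zt : z != t by rewrite eq_sym e_neq.
have oS : o \notin part t by rewrite inE.
have ot : o != t by apply: contraNneq nto => ->; apply: con0.
have [s [r [sS rS st rt esr]]] := no_cutvertex zS zt oS ot.
exists s; split=> //; have sA' := subsetP sA s sS.
have : [set s; r] \in D2.
  apply: contraNT rS => nD; rewrite inE in sS; rewrite inE.
  exact: con_trans sS (con1 esr nD).
rewrite !inE => /orP[/orP[]|] /pedge_sub/subsetP/(_ s); rewrite set21 => /(_ isT) sI.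
- by left; apply: side_P.
- by right; apply: side_Q.
have : s \notin inner R.
  apply: (con_not_inner cR _ tI); last by move: sS; rewrite inE; apply.
  exact: subsetUr.
rewrite mem_innerP sI /= negbK ERt => /set2P[] sE; first by rewrite sE eqxx in st.
by rewrite sE (negPf oS) in sS.
Qed.

(** The side of [(P, R)] with [u] and [a] lies in the part of [a], since only [Q] could
    leave it and [Q] ends in the part of [b].  The other side is joined through
    [v], the opposite side, [Q] and [u'] to [b].  The first one is smaller than [A]
    because it misses [b]. *)
Lemma separating_thread_absurd : side_minimal A -> ~~ con D2 a b ->
  con D2 a u -> u != a -> con D2 b u' -> False.
Proof.
move=> minA nab au ua bu'; have [aR bR _ _] := end_R; have [uP vP uI _] := end_P.
have [u'Q v'Q _ _] := end_Q.
have disPR : [disjoint P & R].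
  apply/pred0P => x /=; apply/negP => /andP[xP xR].
  have xu := side_P (subsetP RA x xR) xP; rewrite xu in xR.
  have : u \notin inner R.
    apply/negP => ui; have d2 : degree e u = 2 by case: cR => _ + _ _; apply.
    by have : 2 < degree e u; [case: cP => _ _ _; apply; rewrite EP set21 | rewrite d2].
  rewrite mem_innerP xR /= negbK ER => /set2P[E|E]; first by rewrite E eqxx in ua.
  by case/negP: nab; rewrite -E.
set D3 := cedges P R.
have sD3 : D3 \subset D2 by rewrite setSU // subsetUl.
have ua3 : con D3 u a by rewrite con_sym; apply: con_mono au.
have disQ : [disjoint pedge Q & D3].
  apply/pred0P => f /=; apply/negP => /andP[fQ]; rewrite inE => /orP[fP|fR]; last first.
    by have := pred0P dR f; rewrite /= fR inE fQ orbT.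
  have [x [y [fE _]]] := edgesP _ (subsetP (pedge_edges cP) f fP).
  have xf : x \in f by rewrite fE set21.
  by have := pred0P dis x; rewrite /= (subsetP (pedge_sub fP)) // (subsetP (pedge_sub fQ)).
have vb3 : con D3 v b.
  have : con D3 v v'.
    apply: other_side_con; last by rewrite inE.
    move=> f; rewrite inE => /orP[fP|/pedge_R_side //]; by rewrite inE fP.
  move=> /con_trans; apply; apply: con_trans (cutp_con cQ disQ v'Q u'Q) _.
  by rewrite con_sym; apply: con_mono bu'.
(* Only [Q] could lead out of the part of [a], but it enters [A] in the part of [b]. *)
have in_part x : con D3 u x -> x \in part a.
  move=> cux; apply: con_closed cux _; last by rewrite inE.
  move=> s t sS est nD3; have sA := subsetP (part_sub aR) s sS.
  have nQ : [set s; t] \notin pedge Q.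
    apply/negP => /pedge_sub/subsetP/(_ s); rewrite set21 => /(_ isT) sQ.
    case/negP: nab; move: sS; rewrite (side_Q sA sQ) inE => /con_trans; apply.
    by rewrite con_sym.
  move: sS; rewrite !inE => /con_trans; apply; apply: con1 => //.
  by move: nD3; rewrite !inE !negb_or nQ => /andP[-> ->].
have nuv3 : ~~ con D3 u v.
  apply/negP => /in_part/(subsetP (part_sub aR)); rewrite inE.
  exact/negP.
have [cut comp] := cutsI cP cR disPR EP ER uV aV vV bV ua3 vb3 nuv3.
have sA : side P R u = A.
  apply: (minA P R) => //; first by rewrite comp set21.
  apply/subsetP => x; rewrite inE => /in_part; exact: (subsetP (part_sub aR)).
have : b \in side P R u by rewrite sA (subsetP RA).
rewrite inE => ub; case/negP: nuv3; apply: con_trans ub _; by rewrite con_sym.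
Qed.

End Thread.

End MinimalSide.

(** The two parts contain different ends among [u] and [u']; if they are the
    other way round, [P] and [Q] exchange their roles. *)
Lemma side_branch_type P Q u v u' v' y : cutp P -> cutp Q -> [disjoint P & Q] ->
    ends P = [set u; v] -> ends Q = [set u'; v'] ->
    u \in Va -> v \in Vb -> u' \in Va -> v' \in Vb ->
    con (cedges P Q) u u' -> con (cedges P Q) v v' -> ~~ con (cedges P Q) u v ->
    side_minimal (side P Q u) ->
  y \in side P Q u -> 2 < degree e y -> y \in Va.
Proof.
move=> cP cQ dis EP EQ uV vV u'V v'V uu' vv' nuv minA yA dy.
apply: contraT => yV; exfalso.
have [R [a [b [cR ER [aV bV] RA dR]]]] :=
  thread_in_side cP EP uV yA dy yV.
have nab : ~~ con (cedges P Q :|: pedge R) a b.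
  apply/negP; exact: (nonseparating_thread_absurd cP cQ EP EQ uu' vv' nuv cR ER aV bV RA dR minA).
have nba : ~~ con (cedges P Q :|: pedge R) b a by rewrite con_sym.
have ER' : ends R = [set b; a] by rewrite setUC.
have exit := part_has_end cP cQ dis EP EQ uu' vv' nuv cR RA.
have [s [sE sa nsa]] := exit a b ER nab; have [s' [s'E sb nsb]] := exit b a ER' nba.
rewrite !inE in sa sb.
have ss' : s <> s'.
  by move=> E; case/negP: nab; apply: con_trans sa _; rewrite E con_sym.
case: sE s'E => [] sE [] s'E; try by case: ss'; rewrite sE s'E.
  rewrite sE in sa nsa; rewrite s'E in sb.
  exact: (separating_thread_absurd cP cQ dis EP EQ uV vV uu' vv' nuv cR ER aV bV RA dR minA).
rewrite sE in sa nsa; rewrite s'E in sb.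
have EC : cedges Q P = cedges P Q by rewrite /cedges setUC.
have Eside : side Q P u' = side P Q u by rewrite /side EC; apply/esym/side_eq.
rewrite -Eside in RA minA; rewrite -EC in dR nab sa sb uu' vv' nuv.
apply: (@separating_thread_absurd Q P u' v' u v cQ cP _ EQ EP u'V v'V _ _ _ R a b) => //.
- by rewrite disjoint_sym.
- by rewrite con_sym.
- by rewrite con_sym.
apply: contra nuv => c; apply: con_trans uu' _; apply: con_trans c _.
by rewrite con_sym.
Qed.

(** An edge of [P] or [Q] is never contained in the side of [u], which meets each
    of these paths in one vertex only.  So inclusion of vertex sets already gives
    inclusion of determined subgraphs. *)
Lemma minimal_side_minimal C P Q u v u' v' : cutp P -> cutp Q ->
    ends P = [set u; v] -> ends Q = [set u'; v'] ->
    con (cedges P Q) u u' -> con (cedges P Q) v v' -> ~~ con (cedges P Q) u v ->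
    vset C = side P Q u ->
    eset C = [set f in eset (delete_ints e P Q) | f \subset vset C] ->
    (forall C', determined e Va Vb C' -> subgraph_incl C' C -> C' = C) ->
  side_minimal (side P Q u).
Proof.
move=> cP cQ EP EQ uu' vv' nuv CA CE minC P' Q' X cut XC XA.
pose C' := Subgraph X [set f in eset (delete_ints e P' Q') | f \subset X].
suff CC' : C' = C by rewrite -CA -CC'.
apply: minC; first by exists P', Q'.
have [_ cP' cQ' _] := cut.
split; first by rewrite CA.
rewrite CE; apply/subsetP => f /setIdP[].
rewrite eset_delete_ints // => /setDP[fE _] fX; have fA := subset_trans fX XA.
apply/setIdP; rewrite CA eset_delete_ints // in_setD fE andbT; split=> //.
rewrite inE negb_or; apply/andP; split; apply/negP => /pedge_sub fP.
  have : f \subset [set u].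
    apply/subsetP => x xf; rewrite inE; apply/eqP.
    exact: (side_P cP EP nuv (subsetP fA x xf) (subsetP fP x xf)).
  by move/subset_leq_card; rewrite cards1 card_edge.
have : f \subset [set u'].
  apply/subsetP => x xf; rewrite inE; apply/eqP.
  exact: (side_Q cQ EQ uu' vv' nuv (subsetP fA x xf) (subsetP fP x xf)).
by move/subset_leq_card; rewrite cards1 card_edge.
Qed.

Lemma branch_type C P Q u v u' v' y : cuts e Va Vb P Q ->
    ends P = [set u; v] -> ends Q = [set u'; v'] ->
    u \in Va -> v \in Vb -> u' \in Va -> v' \in Vb ->
    con (cedges P Q) u u' -> con (cedges P Q) v v' -> ~~ con (cedges P Q) u v ->
    vset C = side P Q u ->
    eset C = [set f in eset (delete_ints e P Q) | f \subset vset C] ->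
    (forall C', determined e Va Vb C' -> subgraph_incl C' C -> C' = C) ->
  y \in vset C -> 2 < degree e y -> y \in Va.
Proof.
case=> dis cP cQ _ EP EQ uV vV u'V v'V uu' vv' nuv CA CE minC; rewrite CA.
apply: (side_branch_type cP cQ dis EP EQ) => //.
exact: (minimal_side_minimal cP cQ EP EQ uu' vv' nuv CA CE minC).
Qed.
End EdgeSets.

(** * Exchanging the two types *)
Section Swap.

Variables (T : finType) (e : rel T) (Va Vb : {set T}).

Lemma bipartition_swap : bipartition e Va Vb -> bipartition e Vb Va.
Proof. by case=> U D iA iB; split; rewrite 1?setUC 1?disjoint_sym. Qed.

Lemma cut_path_swap P : cut_path e Va Vb P -> cut_path e Vb Va P.
Proof.
by case=> p i [a [b [E aV bV]]] d; split=> //; exists b, a; split=> //; rewrite setUC.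
Qed.

Lemma cuts_swap P Q : cuts e Va Vb P Q -> cuts e Vb Va P Q.
Proof.
case=> dis /cut_path_swap cP /cut_path_swap cQ [A [B [AB E sA sB]]]; split=> //.
by exists B, A; split=> //; [rewrite eq_sym | rewrite setUC].
Qed.

Lemma determined_swap C : determined e Va Vb C -> determined e Vb Va C.
Proof. by case=> P [Q [/cuts_swap cut comp]]; exists P, Q. Qed.

End Swap.

Theorem theorem1 (T : finType) (e : rel T)
    (e_sym : symmetric e) (e_irr : irreflexive e)
    (e_H : all_cycles_0mod4 e)
    (e_2conn : k_connected e 2)
    (Va Vb : {set T}) (e_bip : bipartition e Va Vb)
    (C : subgraph T) (C_min : minimal_determined e Va Vb C)
    (x y : T) (xC : x \in vset C) (yC : y \in vset C)
    (deg_x : 3 <= degree e x) (deg_y : 3 <= degree e y) :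
  same_type Va Vb x y.
Proof.
case: C_min => [[P [Q [cut [comp CE]]]] minC].
have [u [v [u' [v' [[EP EQ uV u'V [vV v'V]] uu' vv' nuv sides]]]]] :=
  cuts_sides e_sym e_irr cut.
move: comp; rewrite sides => /set2P[] CA; [left | right].
  by split; apply: (branch_type e_sym e_irr e_H e_2conn e_bip cut EP EQ) CA CE minC _ _.
have cut' := cuts_swap cut; have e_bip' := bipartition_swap e_bip.
rewrite setUC in EP; rewrite setUC in EQ.
have nvu : ~~ con e (cedges P Q) v u by rewrite con_sym.
by split; apply: (branch_type e_sym e_irr e_H e_2conn e_bip' cut' EP EQ) CA CE _ _ _ => //
  C' /determined_swap; apply: minC.
Qed.
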